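(* Let $p\ge1$ be an integer, $r\ge 2$, $p+1\ge r$. Let $F=f+g$ on $\mathbb{R}^d$, where $f$ is convex with $L_{p,f}$-Lipschitz $p$-th derivative and $g$ is proper closed convex, let $F$ be $r$-uniformly convex with constant $\sigma_r>0$, and let $x_*$ be its minimizer. Let $R=R_0=\|z_0-x_*\|$. Then CATD with restarts (described in the context), which performs $$N_k=\max\left\{\left\lceil\left(\frac{r\,c_p L_{p,f}2^r}{\sigma_r}R_k^{p+1-r}\right)^{\frac2{3p+1}}\right\rceil,1\right\},\qquad R_k=R_02^{-k},\qquad c_p=\frac{2^{p-1}(p+1)^{\frac{3p+1}{2}}}{(p-1)!},$$ CATD steps in its $k$-th restart, converges, and it reaches accuracy $F(z)-F(x_* )\le\varepsilon$ in a total number $N_F$ of CATD steps, where $$N_F=\tilde O\left[\left(\frac{L_{p,f}R^{p+1-r}}{\sigma_r}\right)^{\frac2{3p+1}}\right].$$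
   Context: $\|\cdot\|$ is the Euclidean norm. $F$ is $r$-uniformly convex with constant $\sigma_r$ if $F(y)\ge F(x)+\langle\nabla F(x),y-x\rangle+\frac{\sigma_r}{r}\|y-x\|^r$ for all $x,y$, where $\nabla F(x)$ denotes a subgradient. $\tilde O$ means up to logarithmic factors (including in $1/\varepsilon$). The Taylor model is $\Omega_p(f,x;y)=f(x)+\sum_{k=1}^p\frac1{k!}D^kf(x)[y-x]^k$; $\nabla\Omega_p(f,x;y)$ is its gradient in $y$. CATD with parameter $H$ applied to $F=f+g$ from $x_0$ (here $H=L_{p,f}$): set $A_0=0$, $y_0=x_0$. For $k=0,1,2,\dots$, compute a pair $\lambda_{k+1}>0$, $y_{k+1}\in\mathbb{R}^d$ such that $$\frac12\le\lambda_{k+1}\frac{H\|y_{k+1}-\tilde x_k\|^{p-1}}{(p-1)!}\le\frac p{p+1},$$ where $$y_{k+1}=\operatorname{argmin}_y\Big\{\Omega_p(f,\tilde x_k;y)+\frac{H}{p!}\|y-\tilde x_k\|^{p+1}+g(y)\Big\},$$ $$a_{k+1}=\frac{\lambda_{k+1}+\sqrt{\lambda_{k+1}^2+4\lambda_{k+1}A_k}}2,\quad A_{k+1}=A_k+a_{k+1},\quad \tilde x_k=\frac{A_k}{A_{k+1}}y_k+\frac{a_{k+1}}{A_{k+1}}x_k$$ (coupled through $\lambda_{k+1}$). Then set $x_{k+1}=x_k-a_{k+1}\nabla f(y_{k+1})-a_{k+1}g'(y_{k+1})$, where $$g'(y_{k+1})=-\nabla\Omega_p(f,\tilde x_k;y_{k+1})-\frac{(p+1)H}{p!}\|y_{k+1}-\tilde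 x_k\|^{p-1}(y_{k+1}-\tilde x_k)\in\partial g(y_{k+1}).$$ The output after $N$ steps is $y_N$. CATD with restarts: set $z_0=x_0=0$, $R_0=\|z_0-x_*\|$. For $k=0,1,2,\dots$: set $R_k=R_02^{-k}$ and $N_k$ as in the claim; let $z_{k+1}:=y_{N_k}$ be the output of CATD started from $z_k$ and run for $N_k$ steps.
   Formalization: The bound on N_F has max(1, (L R^{p+1-r}/σ)^{2/(3p+1)}) in place of the bare power, since each restart makes at least one step and the bare bound fails when L R^{p+1-r}/σ tends to 0. *)

(* Defs.v *)
From HB Require Import structures.
From mathcomp Require Import all_boot all_order all_algebra.
From mathcomp Require Import all_classical all_reals all_analysis.

Set Implicit Arguments.
Unset Strict Implicit.
Unset Printing Implicit Defensive.

Import Order.TTheory GRing.Theory Num.Theory.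
Import numFieldNormedType.Exports.

Local Open Scope classical_set_scope.
Local Open Scope ring_scope.

Section Defs.
Context {R : realType}.

Section Space.
Context {d : nat}.
Local Notation V := 'rV[R]_d.

Definition dot (u v : V) : R := \sum_(i < d) u 0 i * v 0 i.

(* The library norm on ['rV_d] is the sup norm, hence a separate definition;
   both induce the same topology and the same notion of differentiability. *)
Definition enorm (u : V) : R := Num.sqrt (dot u u).

Definition grad (f : V -> R) (x : V) : V := \row_(i < d) 'D_(delta_mx 0 i) f x.

(* [Dform f [:: h1; ...; hk] x] is D^k f(x)[h1, ..., hk]. *)
Definition Dform (f : V -> R) (hs : seq V) : V -> R :=
  foldr (fun h phi => 'D_h phi) f hs.

(* In finite dimension, f is p times Frechet differentiable iff all its
   iterated directional derivatives of order < p are Frechet differentiable. *)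
Definition differentiable_n (p : nat) (f : V -> R) :=
  forall hs : seq V, (size hs < p)%N -> forall x, differentiable (Dform f hs) x.

Definition form_norm (p : nat) (T : seq V -> R) : \bar R :=
  ereal_sup [set `|T hs|%:E | hs in
    [set hs : seq V | size hs = p /\ forall h, h \in hs -> enorm h <= 1]].

Definition lipschitz_Dn (p : nat) (L : R) (f : V -> R) :=
  differentiable_n p f /\
  forall x y, (form_norm p (fun hs => Dform f hs x - Dform f hs y)%R
               <= (L * enorm (x - y))%:E)%E.

Definition taylor (p : nat) (f : V -> R) (x y : V) : R :=
  f x + \sum_(1 <= k < p.+1) k`!%:R^-1 * Dform f (nseq k (y - x)) x.

Definition eproper (g : V -> \bar R) :=
  (exists x, g x != +oo%E) /\ forall x, g x != -oo%E.

(* With [0 * +oo = 0], the endpoints t = 0 and t = 1 are harmless. *)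
Definition econvex (g : V -> \bar R) :=
  forall (x y : V) (t : R), 0 <= t <= 1 ->
    (g (t *: x + (1 - t) *: y)%R <= t%:E * g x + (1 - t)%:E * g y)%E.

Definition eclosed (g : V -> \bar R) :=
  closed [set xt : V * R | (g xt.1 <= xt.2%:E)%E].

Definition subgradient (F : V -> \bar R) (x s : V) :=
  F x \is a fin_num /\ forall y, (F x + (dot s (y - x))%:E <= F y)%E.

Definition uniformly_convex (r sigma : R) (F : V -> \bar R) :=
  forall x s, subgradient F x s -> forall y,
    (F x + (dot s (y - x) + sigma / r * enorm (y - x) `^ r)%:E <= F y)%E.

Definition minimizer (F : V -> \bar R) (x : V) := forall y, (F x <= F y)%E.

Definition composite (f : V -> R) (g : V -> \bar R) (x : V) : \bar R :=
  ((f x)%:E + g x)%E.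

Record catd_state := CatdState { st_A : R; st_x : V; st_y : V }.

(* One CATD iteration as a relation: the pair (lambda, y_{k+1}) is only
   constrained by the coupled conditions, not computed. *)
Definition catd_step (p : nat) (H : R) (f : V -> R) (g : V -> \bar R)
    (s s' : catd_state) :=
  exists lambda : R,
    let a := (lambda + Num.sqrt (lambda ^+ 2 + 4 * lambda * st_A s)) / 2 in
    let A' := st_A s + a in
    let xt := (st_A s / A') *: st_y s + (a / A') *: st_x s in
    let y' := st_y s' in
    let dist := enorm (y' - xt) in
    let model y := taylor p f xt y + H / p`!%:R * enorm (y - xt) ^+ p.+1 in
    let g' := - grad (taylor p f xt) y'
              - (p.+1%:R * H / p`!%:R * dist ^+ p.-1) *: (y' - xt) in
    [/\ 0 < lambda,
        1 / 2 <= lambda * (H * dist ^+ p.-1 / p.-1`!%:R) <= p%:R / p.+1%:R,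
        minimizer (composite model g) y',
        st_A s' = A' &
        st_x s' = st_x s - a *: grad f y' - a *: g'].

Definition catd (p : nat) (H : R) (f : V -> R) (g : V -> \bar R)
    (x0 : V) (N : nat) (out : V) :=
  exists s : nat -> catd_state,
    [/\ s 0%N = CatdState 0 x0 x0,
        forall k, (k < N)%N -> catd_step p H f g (s k) (s k.+1) &
        out = st_y (s N)].

End Space.

Definition catd_const (p : nat) : R :=
  2 ^+ p.-1 * p.+1%:R `^ ((3 * p + 1)%:R / 2) / p.-1`!%:R.

Definition restart_radius (R0 : R) (k : nat) : R := R0 * 2 ^- k.

Definition restart_steps (p : nat) (r L sigma R0 : R) (k : nat) : nat :=
  maxn `|Num.ceil ((r * catd_const p * L * 2 `^ r / sigma
                    * restart_radius R0 k `^ (p%:R + 1 - r))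
                   `^ (2 / (3 * p + 1)%:R))|%N 1.

(* [z] is a run of (at least) the first K restarts.  Bounding the number of
   restarts also covers runs which cannot be continued, e.g. because an exact
   minimizer has been reached: there, for p >= 2, no admissible lambda exists. *)
Definition restarted_catd (d p : nat) (r L sigma : R) (f : 'rV[R]_d -> R)
    (g : 'rV[R]_d -> \bar R) (R0 : R) (K : nat) (z : nat -> 'rV[R]_d) :=
  z 0%N = 0 /\
  forall k, (k < K)%N ->
    catd p L f g (z k) (restart_steps p r L sigma R0 k) (z k.+1).

End Defs.

(* Main.v *)
(** Each CATD step is an inexact proximal step: Taylor's theorem for the gradient
    gives [|lam v + y' - xt| <= |y' - xt| / 2] for a subgradient [v] of [F] at [y'].
    Since [a ^+ 2 = lam A'], the quantity [A (F y - F xs) + |x - xs| ^+ 2 / 2]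
    then decreases by at least [3/8 q] with [q = A' |y' - xt| ^+ 2 / lam], so the
    sum of the [q]'s is at most [4/3 |x0 - xs| ^+ 2].  On the other hand
    [W = (4 A) `^ (p + 1)^-1] satisfies
    [kappa <= (W' - W) ^+ (2 p + 2) * q ^+ (p - 1)] at each step, and summing with the
    AM-GM inequality yields [A_N >= const * N `^ ((3 p + 1) / 2) / (L R ^+ (p - 1))].
    Uniform convexity turns the resulting bound on [F y_N - F xs] into a halving of
    the distance to [xs] per restart; logarithmically many restarts suffice, each
    costing at most a constant times the number of steps of the first one. *)
Require Import Defs.
From HB Require Import structures.
From mathcomp Require Import all_boot all_order all_algebra.
From mathcomp Require Import all_classical all_reals all_analysis.
From mathcomp Require Import ring lra zify.

Import Order.TTheory GRing.Theory Num.Theory.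
Import numFieldNormedType.Exports.

Local Open Scope classical_set_scope.
Local Open Scope ring_scope.

Set Implicit Arguments.
Unset Strict Implicit.
Unset Printing Implicit Defensive.

(** * Iterated directional derivatives *)

Section LineDerivatives.
Context {R : realType} {V : normedModType R}.
Implicit Types (f : V -> R) (x u a b : V).

Lemma is_derive_line f x u (t : R) : derivable f (x + t *: u) u ->
  is_derive t 1 (fun s => f (x + s *: u)) ('D_u f (x + t *: u)).
Proof.
rewrite /derivable /derive => df.
have E : (fun h => h^-1 *: (((fun s => f (x + s *: u)) \o shift t) (h *: (1 : R))
      - f (x + t *: u)))
  = (fun h => h^-1 *: ((f \o shift (x + t *: u)) (h *: u) - f (x + t *: u))).
  apply/funext => h /=; congr (_ *: (f _ - _)).
  by rewrite [h *: 1]mulr1 scalerDl addrCA.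
by split; rewrite /derivable /derive E.
Qed.

Lemma is_derive_at0 f x u (l : R) :
  is_derive (0 : R) (1 : R) (fun t => f (t *: u + x)) l -> is_derive x u f l.
Proof.
have E : (fun h => h^-1 *: ((f \o shift x) (h *: u) - f x)) =
    (fun h => h^-1 *: (((fun t : R => f (t *: u + x)) \o shift 0) (h *: (1 : R))
      - f (0 *: u + x))).
  by apply/funext => h /=; rewrite addr0 scale0r add0r [h *: 1]mulr1.
by case=> df Df; split; rewrite /derivable /derive E.
Qed.

(** The mean value theorem along [a] turns the second difference into [t] times a difference of two
    values of ['D_a f] near [x]; differentiability of ['D_a f] at [x] linearizes both. *)
Lemma mixed_difference_quotient f a b x (e : R) :
  (forall y, derivable f y a) -> differentiable ('D_a f) x -> 0 < e ->
  \forall t \near 0^'+,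
    `|f (x + t *: a + t *: b) - f (x + t *: a) - f (x + t *: b) + f x
      - t ^+ 2 * 'D_b ('D_a f) x| <= e * t ^+ 2.
Proof.
move=> da dda e0.
(* Two linearizations, each with error [c] times [t] times the sum of the norms, cost at most
   [e * t] together; the [+ 1] covers [a = b = 0]. *)
pose c := e / (2 * (`|a| + `|b| + 1)).
have n0 : 0 < `|a| + `|b| + 1 by rewrite ltr_wpDl// addr_ge0.
have c0 : 0 < c by rewrite divr_gt0// mulr_gt0.
have cE (t : R) : 0 < t -> c * (t * (`|a| + `|b|)) * 2 <= e * t.
  move=> t0; have -> : c * (t * (`|a| + `|b|)) * 2
      = e * t * ((`|a| + `|b|) / (`|a| + `|b| + 1)).
    by rewrite /c; field; rewrite gt_eqF.
  rewrite ler_piMr ?mulr_ge0 ?(ltW e0) ?(ltW t0)// ler_pdivrMr// mul1r.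
  by rewrite lerDl.
have /diff_locallyP[_ /eqaddoP /(_ _ c0)] := dda.
rewrite -nbhs_nearE => /nbhs_ballP[r /= r0 Hr].
near=> t.
have t0 : 0 < t by [].
have tr : t * (`|a| + `|b| + 1) < r.
  by rewrite -ltr_pdivlMr//; near: t; apply: nbhs_right_lt; rewrite divr_gt0.
have st w : `|w| <= t * (`|a| + `|b|) ->
    `|'D_a f (x + w) - 'D_a f x - 'd ('D_a f) x w| <= c * (t * (`|a| + `|b|)).
  move=> wt.
  have /Hr : ball (0:V) r w.
    rewrite -ball_normE /ball_/= sub0r normrN.
    by apply: le_lt_trans wt _; apply: lt_trans tr; rewrite ltr_pM2l// ltrDl.
  rewrite -[(_ - _ : _ -> _) _]/(_ - _) /= -[(_ + _ : _ -> _) _]/(_ + _) /=.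
  rewrite [w + x]addrC opprD addrA => H; apply: le_trans H _.
  by rewrite ler_wpM2l// ltW.
pose m (s : R) : R := f (x + t *: b + s *: a) - f (x + s *: a).
have dm (s : R) : is_derive s (1 : R) m ('D_a f (x + t *: b + s *: a) - 'D_a f (x + s *: a)).
  by apply: is_deriveB; apply: is_derive_line.
have [s /[!in_itv]/= /andP[s0 stt]] : exists2 s, s \in `]0, t[%R &
    m t - m 0 = ('D_a f (x + t *: b + s *: a) - 'D_a f (x + s *: a)) * (t - 0).
  apply: MVT => //; apply: derivable_within_continuous => y _.
  exact: ex_derive.
rewrite /m subr0 !scale0r !addr0 => Hm.
have -> : f (x + t *: a + t *: b) - f (x + t *: a) - f (x + t *: b) + f x
   = ('D_a f (x + t *: b + s *: a) - 'D_a f (x + s *: a)) * t.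
  by rewrite -Hm [x + t *: a + _]addrAC; ring.
have sa : `|s *: a| <= t * `|a|.
  by rewrite normrZ gtr0_norm// ler_wpM2r// ltW.
have H1 := st (s *: a) _; have H2 := st (t *: b + s *: a) _.
have {}H1 : `|'D_a f (x + s *: a) - 'D_a f x - 'd ('D_a f) x (s *: a)|
    <= c * (t * (`|a| + `|b|)).
  by apply: H1; apply: le_trans sa _; rewrite ler_wpM2l ?lerDl// ltW.
have {}H2 : `|'D_a f (x + (t *: b + s *: a)) - 'D_a f x - 'd ('D_a f) x (t *: b + s *: a)|
    <= c * (t * (`|a| + `|b|)).
  apply: H2; apply: le_trans (ler_normD _ _) _.
  by rewrite addrC mulrDr lerD// normrZ gtr0_norm.
rewrite linearD linearZ -deriveE // -[X in _ - _ - (X + _)]/(t * _) addrA in H2.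
set D1 := 'D_a f (x + t *: b + s *: a) in H2 *.
set D2 := 'D_a f (x + s *: a) in H1 *.
have -> : (D1 - D2) * t - t ^+ 2 * 'D_b ('D_a f) x = (D1 - D2 - t * 'D_b ('D_a f) x) * t.
  by ring.
rewrite normrM (gtr0_norm t0) expr2 mulrA ler_wpM2r ?(ltW t0)//.
apply: le_trans (cE _ t0).
move: H1 H2; rewrite !ler_norml => /andP[H1 H1'] /andP[H2 H2'].
by apply/andP; split; lra.
Unshelve. all: by end_near. Qed.

(* Young's theorem: no continuity of the second derivatives is needed. *)
Lemma derive_sym f a b x :
  (forall y, derivable f y a) -> (forall y, derivable f y b) ->
  differentiable ('D_a f) x -> differentiable ('D_b f) x ->
  'D_a ('D_b f) x = 'D_b ('D_a f) x.
Proof.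
move=> da db dda ddb; apply/eqP; rewrite -subr_eq0 -normr_le0.
apply/ler_addgt0Pl => e e0; rewrite addr0.
have e20 : 0 < e / 2 by rewrite divr_gt0.
(* The second difference is symmetric in [a] and [b], so for a common small [t] both mixed
   derivatives lie within [e / 2] of the same quotient. *)
have Ha := mixed_difference_quotient b da dda e20.
have Hb := mixed_difference_quotient a db ddb e20.
have [t [[t0 {}Ha] {}Hb]] :=
  filter_ex (filterI (filterI (nbhs_right_gt (0 : R)) Ha) Hb).
have t20 : 0 < t ^+ 2 by rewrite exprn_gt0.
have E : f (x + t *: b + t *: a) = f (x + t *: a + t *: b).
  by congr f; apply: addrAC.
rewrite -(ler_pM2r t20) -[X in _ * X <= _](gtr0_norm t20) -normrM.
move: Ha Hb; move: (f (x + t *: b + t *: a)) E => _ ->.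
move: ('D_b _ _) ('D_a _ _) (f _) (f _) (f _) (f _) => A B c1 c2 c3 c4.
rewrite /= !ler_norml => /andP[H1 H1'] /andP[H2 H2'].
by apply/andP; split; lra.
Qed.

End LineDerivatives.

Section IteratedDerivatives.
Context {R : realType} {d : nat}.
Local Notation V := 'rV[R]_d.
Variables (p : nat) (f : V -> R).
Hypothesis fp : differentiable_n p f.
Implicit Types (u v h a b x z : V) (s : seq V).

Lemma Dform_derivable s z h : (size s < p)%N -> derivable (Dform f s) z h.
Proof. by move=> sp; apply/diff_derivable/fp. Qed.

(** Differentiability yields linearity in the outermost slot; the other slots follow once symmetry
    moves any entry to the front. *)
Lemma Dform_cons_lin s u h (t : R) z : (size s < p)%N ->
  Dform f ((u + t *: h) :: s) z = Dform f (u :: s) z + t * Dform f (h :: s) z.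
Proof.
move=> sp; rewrite /= !deriveE; try exact: fp.
by rewrite linearD linearZ.
Qed.

Lemma Dform_swap a b s : ((size s).+1 < p)%N ->
  Dform f [:: a, b & s] = Dform f [:: b, a & s].
Proof.
move=> sp; apply/funext => z /=; apply: derive_sym => [y|y||].
- by apply: Dform_derivable; apply: ltnW.
- by apply: Dform_derivable; apply: ltnW.
- exact: (fp (hs := a :: s)).
- exact: (fp (hs := b :: s)).
Qed.

Lemma Dform_cat_cons s1 s2 a : (size s1 + size s2 < p)%N ->
  Dform f (s1 ++ a :: s2) = Dform f (a :: s1 ++ s2).
Proof.
elim: s1 => //= b s1 IH sp; rewrite IH; last by apply: ltnW.
by apply: Dform_swap; rewrite size_cat.
Qed.

(** Induction on [k]: symmetry and linearity split off one factor [u + r *: h], then the product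
    rule applies. The tail [s] is arbitrary because the induction moves [u] or [h] into it. At
    [k = 0] the zero coefficient makes [k.-1] harmless. *)
Lemma Dform_nseq_derive k s u h (t : R) z : (k + size s <= p)%N ->
  is_derive t (1 : R) (fun r : R => Dform f (nseq k (u + r *: h) ++ s) z)
    (k%:R * Dform f (h :: nseq k.-1 (u + t *: h) ++ s) z).
Proof.
elim: k s => [|k IH] s ks.
  by rewrite mul0r; apply: is_derive_cst.
have sz (r : R) : (size (nseq k (u + r *: h)%R) + size s < p)%N.
  by rewrite size_nseq.
have E (r : R) : Dform f (nseq k.+1 (u + r *: h) ++ s) z =
   Dform f (nseq k (u + r *: h) ++ u :: s) z
    + r * Dform f (nseq k (u + r *: h) ++ h :: s) z.
  rewrite !Dform_cat_cons// -Dform_cons_lin//.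
  by rewrite size_cat.
rewrite (_ : (fun r => _) = (fun r : R => Dform f (nseq k (u + r *: h) ++ u :: s) z)
    + (@id R) * (fun r : R => Dform f (nseq k (u + r *: h) ++ h :: s) z)); last first.
  by apply/funext => r; rewrite [LHS]E.
have ks' : (k + (size s).+1 <= p)%N by rewrite addnS.
have H1 := IH (u :: s) ks'; have H2 := IH (h :: s) ks'.
have H3 := is_deriveD H1 (is_deriveM (is_derive_id t (1 : R)) H2).
apply: is_derive_eq H3 _.
have scaleE (a b : R) : a *: b = a * b by [].
rewrite !scaleE {scaleE} mulr1 {H1 H2 E IH ks'}.
rewrite [Dform f (nseq k _ ++ h :: s)]Dform_cat_cons//.
(* For a single factor the induction terms have coefficient 0; otherwise linearity recombines them
   into further copies of the remaining term. *)
case: k ks sz => [|k] ks sz.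
  move: (Dform f (h :: nseq 0 _ ++ s) z) (Dform f _ z) (Dform f _ z) => c1 c2 c3.
  by ring.
rewrite -[h :: nseq k.+1.-1 _ ++ u :: _]/((h :: nseq k _) ++ u :: s).
rewrite -[h :: nseq k.+1.-1 _ ++ h :: _]/((h :: nseq k _) ++ h :: s).
have sz1 : (size (h :: nseq k (u + t *: h)%R) + size s < p)%N.
  by rewrite /= size_nseq.
rewrite (Dform_cat_cons u sz1) (Dform_cat_cons h sz1) -[id t]/t.
rewrite addrA mulrCA -mulrDr -Dform_cons_lin; last by rewrite size_cat.
rewrite -[h :: nseq k.+2.-1 _ ++ s]/[:: h, u + t *: h & nseq k (u + t *: h) ++ s].
rewrite -[h :: nseq k.+1 _ ++ s]/[:: h, u + t *: h & nseq k (u + t *: h) ++ s].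
rewrite -Dform_swap; last by rewrite /= size_cat.
by rewrite [k.+2%:R]mulrSr mulrDl mul1r.
Qed.

End IteratedDerivatives.

(** * Euclidean norm and Taylor remainder *)

Section EuclideanSpace.
Context {R : realType} {d : nat}.
Local Notation V := 'rV[R]_d.
Implicit Types (u v w : V) (t : R).

Lemma dotC u v : dot u v = dot v u.
Proof. by apply: eq_bigr => i _; rewrite mulrC. Qed.

Lemma dotDl u v w : dot (u + v) w = dot u w + dot v w.
Proof. by rewrite -big_split; apply: eq_bigr => i _; rewrite mxE mulrDl. Qed.

Lemma dotZl t u v : dot (t *: u) v = t * dot u v.
Proof. by rewrite mulr_sumr; apply: eq_bigr => i _; rewrite mxE mulrA. Qed.

Lemma dotNl u v : dot (- u) v = - dot u v.
Proof. by rewrite -scaleN1r dotZl mulN1r. Qed.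

Lemma dotBl u v w : dot (u - v) w = dot u w - dot v w.
Proof. by rewrite dotDl dotNl. Qed.

Lemma dotDr u v w : dot w (u + v) = dot w u + dot w v.
Proof. by rewrite !(dotC w) dotDl. Qed.

Lemma dotZr t u v : dot v (t *: u) = t * dot v u.
Proof. by rewrite !(dotC v) dotZl. Qed.

Lemma dotBr u v w : dot w (u - v) = dot w u - dot w v.
Proof. by rewrite !(dotC w) dotBl. Qed.

Lemma dot0l u : dot 0 u = 0.
Proof. by rewrite -(scale0r u) dotZl mul0r. Qed.

Lemma dot_ge0 u : 0 <= dot u u.
Proof. by apply: sumr_ge0 => i _; rewrite -expr2 sqr_ge0. Qed.

Lemma enorm_ge0 u : 0 <= enorm u.
Proof. exact: sqrtr_ge0. Qed.

Lemma sqr_enorm u : enorm u ^+ 2 = dot u u.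
Proof. by rewrite sqr_sqrtr// dot_ge0. Qed.

Lemma coord_le_enorm u i : `|u 0 i| <= enorm u.
Proof.
rewrite -ler_sqr ?nnegrE ?enorm_ge0// sqr_enorm real_normK ?num_real//.
rewrite /dot (bigD1 i)//= -expr2 lerDl.
by apply: sumr_ge0 => j _; rewrite -expr2 sqr_ge0.
Qed.

Lemma enorm_eq0 u : enorm u = 0 -> u = 0.
Proof.
move=> u0; apply/rowP => i; rewrite mxE; apply/eqP.
by rewrite -normr_le0 -u0 coord_le_enorm.
Qed.

Lemma enormZ t u : enorm (t *: u) = `|t| * enorm u.
Proof.
by rewrite /enorm dotZl dotZr mulrA -expr2 sqrtrM ?sqr_ge0// sqrtr_sqr.
Qed.

Lemma enormN u : enorm (- u) = enorm u.
Proof. by rewrite -scaleN1r enormZ normrN1 mul1r. Qed.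

Lemma ler_dot_enorm u v : dot u v <= enorm u * enorm v.
Proof.
have [v0|v0] := eqVneq (enorm v) 0.
  by rewrite v0 mulr0 (enorm_eq0 v0) dotC dot0l.
have vp : 0 < enorm v by rewrite lt_def v0 enorm_ge0.
have [u0|u0] := eqVneq (enorm u) 0.
  by rewrite u0 mul0r (enorm_eq0 u0) dot0l.
have up : 0 < enorm u by rewrite lt_def u0 enorm_ge0.
(* The square of this vector is 2|u||v| (|u||v| - <u,v>). *)
have := dot_ge0 (enorm v *: u - enorm u *: v).
rewrite !dotBl !dotBr !dotZl !dotZr -!sqr_enorm (dotC v u).
have -> : enorm v * (enorm v * enorm u ^+ 2) - enorm v * (enorm u * dot u v) -
   (enorm u * (enorm v * dot u v) - enorm u * (enorm u * enorm v ^+ 2)) =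
   2 * (enorm u * enorm v) * (enorm u * enorm v - dot u v) by ring.
by rewrite pmulr_rge0 ?subr_ge0// !mulr_gt0.
Qed.

Lemma ler_enormD u v : enorm (u + v) <= enorm u + enorm v.
Proof.
rewrite -ler_sqr ?nnegrE ?addr_ge0 ?enorm_ge0// sqr_enorm.
rewrite dotDl !dotDr (dotC v u) -!sqr_enorm.
by have := ler_dot_enorm u v; nra.
Qed.

Lemma enorm_le_dual u (c : R) : 0 <= c ->
  (forall h, enorm h <= 1 -> dot u h <= c) -> enorm u <= c.
Proof.
move=> c0 uc; have [->//|u0] := eqVneq (enorm u) 0.
have up : 0 < enorm u by rewrite lt_def u0 enorm_ge0.
have := uc ((enorm u)^-1 *: u); rewrite enormZ dotZr -sqr_enorm.
by rewrite ger0_norm ?invr_ge0 ?enorm_ge0// mulVf// expr2 mulKf//; apply.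
Qed.

(** Assuming only directional derivatives that are linear in the direction makes this apply to the
    Taylor model, for which exactly these are computed below. *)
Lemma dot_gradE (phi : V -> R) x (l : V -> R) :
  (forall h, 'D_h phi x = l h) ->
  (forall u h t, l (u + t *: h) = l u + t * l h) ->
  forall h, dot (grad phi x) h = l h.
Proof.
move=> dl llin h.
have l0 : l 0 = 0.
  have := llin 0 0 1; rewrite scale1r addr0 mul1r => /eqP.
  by rewrite -subr_eq subrr eq_sym => /eqP.
rewrite [in RHS](row_sum_delta h).
have -> : l (\sum_j h 0 j *: delta_mx 0 j) = \sum_j h 0 j * l (delta_mx 0 j).
  elim/big_ind2: _ => //= [|i _]; last first.
    by rewrite -[_ *: _]add0r llin l0 add0r.
  by move=> a a' b b' <- <-; rewrite -[X in _ + X]scale1r llin mul1r.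
by apply: eq_bigr => i _; rewrite mxE dl mulrC.
Qed.

Lemma dot_grad (phi : V -> R) x h : differentiable phi x ->
  dot (grad phi x) h = 'D_h phi x.
Proof.
move=> dphi; rewrite (dot_gradE (l := fun h => 'D_h phi x))// => u k t.
by rewrite !deriveE// linearD linearZ.
Qed.

End EuclideanSpace.

Section TaylorRemainder.
Context {R : realType}.
Implicit Types (c t : R).

Lemma factSr_cancel n : (n.+1`!%:R)^-1 * n.+1%:R = (n`!%:R)^-1 :> R.
Proof.
by rewrite factS natrM invfM mulrAC mulVf ?mul1r// pnatr_eq0.
Qed.

(** Replaces integration of the bound on [dg]: the mean value theorem is applied to [g] minus the
    claimed bound, whose derivative is nonpositive on [0, 1]. *)
Lemma mean_value_bound (g dg : R -> R) n c :
  (forall t, is_derive t (1 : R) g (dg t)) -> g 0 = 0 ->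
  (forall t, 0 <= t <= 1 -> dg t <= c * t ^+ n / n`!%:R) ->
  forall t, 0 <= t <= 1 -> g t <= c * t ^+ n.+1 / n.+1`!%:R.
Proof.
move=> dgP g0 dgle t /andP[t0 t1].
have [->|tN0] := eqVneq t 0; first by rewrite g0 expr0n mulr0 mul0r.
have tp : 0 < t by rewrite lt_def tN0.
pose m (s : R) : R := g s - c / n.+1`!%:R * s ^+ n.+1.
have dm (s : R) : is_derive s (1 : R) m (dg s - c * s ^+ n / n`!%:R).
  have H := @is_deriveX _ _ (@id R) n.+1 s 1 1 (is_derive_id s 1).
  rewrite (_ : m = g - (c / n.+1`!%:R) *: (@id R ^+ n.+1)); last first.
    by apply/funext => y; rewrite /m -[RHS]/(g y - _ * (@id R ^+ n.+1) y) exprfctE.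
  apply: is_derive_eq (is_deriveB (dgP s) (is_deriveZ (c / n.+1`!%:R) H)) _.
  rewrite -[X in _ - X]/(c / n.+1`!%:R * (n.+1%:R * s ^+ n * 1)).
  by rewrite mulr1 -(factSr_cancel n); ring.
have [s /[!in_itv]/= /andP[s0 st]] : exists2 s, s \in `]0, t[%R &
    m t - m 0 = (dg s - c * s ^+ n / n`!%:R) * (t - 0).
  apply: MVT => //; apply: derivable_within_continuous => y _.
  exact: ex_derive.
rewrite /m g0 expr0n mulr0 !subr0 => H.
have : g t - c / n.+1`!%:R * t ^+ n.+1 <= 0.
  rewrite H pmulr_lle0// subr_le0 dgle// (ltW s0)/=.
  by apply: le_trans t1; apply: ltW.
by rewrite subr_le0 mulrAC.
Qed.

(** Here [phi j] plays the j-th derivative. The derivative of a remainder is the remainder of the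
    shifted family, so induction and [mean_value_bound], applied to the remainder and to its
    opposite, give both sides. *)
Lemma taylor_remainder (phi : nat -> R -> R) n c :
  (forall j t, (j < n)%N -> is_derive t (1 : R) (phi j) (phi j.+1 t)) ->
  (forall t, 0 <= t <= 1 -> `|phi n t - phi n 0| <= c * t) ->
  forall t, 0 <= t <= 1 ->
    `|phi 0%N t - \sum_(i < n.+1) t ^+ i / i`!%:R * phi i 0|
      <= c * t ^+ n.+1 / n.+1`!%:R.
Proof.
elim: n phi => [|n IH] phi dphi lip t t01.
  by rewrite big_ord_recl big_ord0 expr0 divr1 mul1r addr0 divr1 expr1 lip.
have {}IH := IH (fun j => phi j.+1) (fun j s jn => dphi j.+1 s jn) lip.
pose psi (s : R) : R := phi 0%N s - \sum_(i < n.+2) s ^+ i / i`!%:R * phi i 0.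
pose dpsi (s : R) : R := phi 1%N s - \sum_(i < n.+1) s ^+ i / i`!%:R * phi i.+1 0.
have dpsiP (s : R) : is_derive s (1 : R) psi (dpsi s).
  rewrite (_ : psi = phi 0%N - \sum_(i < n.+2) (phi i 0 / i`!%:R) *: (@id R ^+ i)); last first.
    apply/funext => y; rewrite /psi -[RHS]/(_ y - _ y); congr (_ - _).
    rewrite fct_sumE; apply: eq_bigr => i _.
    rewrite -[RHS]/(_ * (@id R ^+ i) y) exprfctE; ring.
  have d0 := dphi 0%N s isT.
  apply: is_derive_eq.
  rewrite /dpsi big_ord_recl; congr (_ - _).
  rewrite mul0r scale0r scaler0 add0r.
  apply: eq_bigr => i _.
  rewrite -[LHS]/(phi i.+1 0 / (bump 0 i)`!%:R * ((bump 0 i)%:R * s ^+ (bump 0 i).-1 * 1)).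
  rewrite /bump leq0n add1n -(factSr_cancel i) /=.
  by ring.
have psi0 : psi 0 = 0.
  rewrite /psi big_ord_recl expr0 divr1 mul1r big1 ?addr0 ?subrr// => i _.
  by rewrite expr0n mul0r mul0r.
have ub := mean_value_bound dpsiP psi0 (fun s s01 => le_trans (ler_norm _) (IH s s01)) t01.
have lbs s : 0 <= s <= 1 -> - dpsi s <= c * s ^+ n.+1 / n.+1`!%:R.
  by move=> /IH; rewrite ler_norml => /andP[+ _]; rewrite lerNl.
have Npsi0 : (- psi) 0 = 0 by rewrite -[LHS]/(- psi 0) psi0 oppr0.
have lb := mean_value_bound (fun s => is_deriveN (dpsiP s)) Npsi0
   lbs t01.
rewrite -[X in `|X|]/(psi t) ler_norml ub andbT -lerN2 opprK; exact: lb.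
Qed.

End TaylorRemainder.

(** * Gradient of the Taylor model and its distance to the gradient of [f] *)

Section TaylorModel.
Context {R : realType} {d : nat}.
Local Notation V := 'rV[R]_d.
Variables (p : nat) (L : R) (f : V -> R).
Hypothesis L0 : 0 <= L.
Hypothesis fL : lipschitz_Dn p L f.
Implicit Types (u v h x y z : V) (s hs : seq V).

Let fp : differentiable_n p f := fL.1.

(* [dtaylor x u h] is the derivative of the Taylor model at [x + u] along [h]. *)
Definition dtaylor x u h : R :=
  \sum_(i < p) i`!%:R^-1 * Dform f (h :: nseq i u) x.

Lemma dtaylor_lin x w u h (t : R) :
  dtaylor x w (u + t *: h) = dtaylor x w u + t * dtaylor x w h.
Proof.
rewrite /dtaylor mulr_sumr -big_split; apply: eq_bigr => i _.
by rewrite (Dform_cons_lin fp) ?size_nseq//= mulrDr mulrCA.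
Qed.

Lemma is_derive_taylor x y h : is_derive y h (taylor p f x) (dtaylor x (y - x) h).
Proof.
apply: is_derive_at0.
rewrite (_ : (fun t => _) = cst (f x) + \sum_(i < p) i.+1`!%:R^-1 *:
    (fun t : R => Dform f (nseq i.+1 (y - x + t *: h) ++ [::]) x)); last first.
  apply/funext => t; rewrite /taylor -[RHS]/(f x + _ t) fct_sumE.
  rewrite big_add1 big_mkord; congr (_ + _); apply: eq_bigr => i _.
  rewrite -[RHS]/(_ * Dform f (nseq i.+1 (y - x + t *: h) ++ [::]) x) cats0.
  by rewrite -addrA addrC.
have H (i : 'I_p) : is_derive (0 : R) (1 : R)
    (fun t : R => Dform f (nseq i.+1 (y - x + t *: h) ++ [::]) x)
    (i.+1%:R * Dform f (h :: nseq i (y - x)) x).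
  have := @Dform_nseq_derive _ _ _ _ fp i.+1 [::] (y - x) h 0 x.
  by rewrite scale0r addr0 !cats0 addn0 => /(_ (ltn_ord i)).
apply: is_derive_eq (is_deriveD (is_derive_cst (f x) _ _)
  (is_derive_sum (fun i => is_deriveZ (i.+1`!%:R^-1) (H i)))) _.
rewrite add0r; apply: eq_bigr => i _.
rewrite -[LHS]/(_ * (_ * _)) mulrA; congr (_ * _); exact: factSr_cancel.
Qed.

Lemma dot_grad_taylor x y h : dot (grad (taylor p f x) y) h = dtaylor x (y - x) h.
Proof.
apply: dot_gradE => [{}h|*]; last exact: dtaylor_lin.
by have H := is_derive_taylor x y h; apply: derive_val.
Qed.

Lemma Dform_nseq_scale k s u (c : R) z : (k + size s <= p)%N ->
  Dform f (nseq k (c *: u) ++ s) z = c ^+ k * Dform f (nseq k u ++ s) z.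
Proof.
elim: k s => [|k IH] s ks; first by rewrite mul1r.
have sz v : (size (nseq k v) + size s < p)%N by rewrite size_nseq.
(* Homogeneity is read off [Dform_cons_lin] at [0 + c *: u], whose constant term must vanish. *)
have cons0 v : Dform f (0 :: nseq k v ++ s) z = 0.
  exact: derive0.
rewrite -![nseq k.+1 _ ++ s]/(_ :: nseq k _ ++ s) -!(Dform_cat_cons fp) ?size_nseq//.
rewrite IH /= ?addnS// !(Dform_cat_cons fp) ?size_nseq//.
rewrite -[X in X :: _]add0r (Dform_cons_lin fp) ?size_cat ?size_nseq//.
by rewrite cons0 add0r mulrA -exprSr.
Qed.

Lemma Dform_lipschitz hs x y : size hs = p -> (forall h, h \in hs -> enorm h <= 1) ->
  `|Dform f hs x - Dform f hs y| <= L * enorm (x - y).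
Proof.
move=> hsp hs1; rewrite -lee_fin; apply: le_trans (fL.2 x y).
by apply: ereal_sup_ubound; exists hs.
Qed.

(** The Lipschitz condition tests vectors of norm at most 1, so [u] is normalized: its p - 1 slots
    and the increment [t *: u] contribute the p factors |u|. *)
Lemma Dform_lipschitz_line u h x (t : R) : (0 < p)%N -> 0 <= t -> enorm h <= 1 ->
  `|Dform f (h :: nseq p.-1 u) (x + t *: u) - Dform f (h :: nseq p.-1 u) x|
    <= L * enorm u ^+ p * t.
Proof.
move=> p0 t0 h1; have c0 : 0 <= L * enorm u ^+ p * t.
  by rewrite !mulr_ge0// exprn_ge0// enorm_ge0.
have [u0|u0] := eqVneq (enorm u) 0.
  by rewrite (enorm_eq0 u0) scaler0 addr0 subrr normr0 -{1}(enorm_eq0 u0).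
have up : 0 < enorm u by rewrite lt_def u0 enorm_ge0.
pose w := (enorm u)^-1 *: u.
have uE : u = enorm u *: w by rewrite scalerA divff// scale1r.
have w1 : enorm w = 1.
  by rewrite enormZ ger0_norm ?invr_ge0 ?enorm_ge0// mulVf.
have E z : Dform f (h :: nseq p.-1 u) z
    = enorm u ^+ p.-1 * Dform f (nseq p.-1 w ++ [:: h]) z.
  rewrite -Dform_nseq_scale; last by rewrite addn1 prednK.
  by rewrite -uE (Dform_cat_cons fp) ?cats0// size_nseq addn0 prednK.
rewrite !E -mulrBr normrM (ger0_norm (exprn_ge0 _ (enorm_ge0 u))).
have := @Dform_lipschitz (nseq p.-1 w ++ [:: h]) (x + t *: u) x.
rewrite size_cat size_nseq addn1 prednK// => /(_ erefl).
have H : forall h' : V, h' \in nseq p.-1 w ++ [:: h] -> enorm h' <= 1.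
  move=> h'; rewrite mem_cat mem_nseq inE => /orP[/andP[_ /eqP->]|/eqP->//].
  by rewrite w1.
move=> /(_ H); rewrite addrAC subrr add0r enormZ (ger0_norm t0) => Hl.
have -> : L * enorm u ^+ p * t = enorm u ^+ p.-1 * (L * (t * enorm u)).
  by rewrite -[in LHS](prednK p0) exprS; ring.
by rewrite ler_wpM2l// exprn_ge0// enorm_ge0.
Qed.

(** Tested against a unit [h], the difference is the Taylor remainder of order p - 1 of the
    directional derivative along [h], restricted to the segment from [x] to [y]. *)
Lemma grad_taylor_bound x y : (0 < p)%N ->
  enorm (grad f y - grad (taylor p f x) y) <= L / p`!%:R * enorm (y - x) ^+ p.
Proof.
move=> p0; apply: enorm_le_dual => [|h h1].
  by rewrite !mulr_ge0 ?invr_ge0// exprn_ge0// enorm_ge0.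
rewrite dotBl dot_grad ?dot_grad_taylor; last exact: (fp (hs := [::])).
set u := y - x.
pose phi j (t : R) := Dform f (h :: nseq j u) (x + t *: u).
have dphi j (t : R) : (j < p.-1)%N -> is_derive t (1 : R) (phi j) (phi j.+1 t).
  move=> jp; have jp' : (j.+1 < p)%N by rewrite -(prednK p0).
  (* The new [u] must be the outermost direction to be a derivative along the segment. *)
  have swapE : Dform f [:: h, u & nseq j u] = Dform f [:: u, h & nseq j u].
    by apply: (Dform_swap fp); rewrite size_nseq.
  have -> : phi j.+1 t = 'D_u (Dform f (h :: nseq j u)) (x + t *: u).
    exact: (congr1 (fun F => F (x + t *: u)) swapE).
  by apply: is_derive_line; apply: (Dform_derivable fp); rewrite /= size_nseq.
have lip (t : R) : 0 <= t <= 1 ->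
    `|phi p.-1 t - phi p.-1 0| <= L * enorm u ^+ p * t.
  move=> /andP[t0 _]; rewrite /phi scale0r addr0.
  exact: Dform_lipschitz_line.
have := taylor_remainder dphi lip (t := 1); rewrite ler01 lexx => /(_ isT).
rewrite expr1n mulr1 prednK// mulrAC => H; apply: le_trans H.
apply: le_trans (ler_norm _); rewrite le_eqVlt; apply/orP; left; apply/eqP.
rewrite /phi scale1r [x + u]addrC subrK; congr (_ - _).
by apply: eq_bigr => i _; rewrite expr1n mul1r scale0r addr0.
Qed.

End TaylorModel.

(** * Optimality conditions and one accelerated step *)

Section PowerInequalities.
Context {R : realType}.

(** AM-GM for [m] copies of [x] and [n] copies of [y], cleared of roots and denominators. *)
Lemma weighted_agm (m n : nat) (x y : R) : 0 <= x -> 0 <= y ->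
  x ^+ m * y ^+ n * (m + n)%:R ^+ (m + n) <= (m%:R * x + n%:R * y) ^+ (m + n).
Proof.
move=> x0 y0; have [mn0|mn0] := posnP (m + n)%N.
  by move/eqP: mn0; rewrite addn_eq0 => /andP[/eqP-> /eqP->]; rewrite !expr0 !mulr1.
pose E (i : 'I_m + 'I_n) := if i is inl _ then x else y.
have [] := @leif_AGM R ('I_m + 'I_n)%type predT E _.
  by case=> i _ /=.
rewrite card_sum !card_ord !big_sumType /= !prodr_const !sumr_const !card_ord.
move=> H _; rewrite -ler_pdivlMr ?exprn_gt0 ?ltr0n//.
by rewrite -expr_div_n !mulr_natl.
Qed.

(** This is the tangent inequality at u^2 of the convex function s^((p+1)/2). Rearranged, it is
    AM-GM with weights p - 1 and 2. *)
Lemma pow_sub_le (p : nat) (u a : R) : (0 < p)%N -> 0 <= u -> 0 <= a ->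
  2 * (u ^+ p.+1 - a ^+ p.+1) <= p.+1%:R * (u ^+ p.-1 * (u ^+ 2 - a ^+ 2)).
Proof.
case: p => // p _ u0 a0; rewrite succnK.
have := @weighted_agm p 2 (u ^+ p.+2) (a ^+ p.+2) (exprn_ge0 _ u0) (exprn_ge0 _ a0).
rewrite addn2 -!exprM (mulnC p.+2 p) (mulnC p.+2 2) !exprM -!exprMn.
rewrite ler_pXn2r ?nnegrE//; last 2 first.
- by rewrite !mulr_ge0// exprn_ge0.
- by rewrite addr_ge0// mulr_ge0// exprn_ge0.
by rewrite -[p.+2]addn2 natrD !exprD; lra.
Qed.

End PowerInequalities.

Section Optimality.
Context {R : realType} {d : nat}.
Local Notation V := 'rV[R]_d.
Implicit Types (x y z h w v : V).

(** Division by [t] and passage to the limit; [rho] accommodates a term that is controlled only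
    through an upper bound on its increments. *)
Lemma derive_ge (phi : V -> R) y h (c l : R) (rho : R -> R) : derivable phi y h ->
  rho x @[x --> 0^'+] --> l ->
  (forall t, 0 < t -> t <= 1 -> t * c <= phi (y + t *: h) - phi y + t * rho t) ->
  c <= 'D_h phi y + l.
Proof.
move=> /cvg_dnbhs_at_right dphi rhol H.
apply: (cvgr_to_ge (cvgD dphi rhol)); near=> t.
have t0 : 0 < t by [].
have t1 : t <= 1 by near: t; apply: nbhs_right_le.
rewrite -[X in _ <= X]/(t^-1 * (phi (t *: h + y) - phi y) + rho t).
rewrite -(ler_pM2l t0) mulrDr mulrA divff ?gt_eqF// mul1r [t *: h + y]addrC.
exact: H.
Unshelve. all: by end_near. Qed.

Lemma convex_grad_le (f : V -> R) y z : convex_function setT f ->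
  differentiable f y -> f y + dot (grad f y) (z - y) <= f z.
Proof.
move=> cf df; rewrite dot_grad// -lerBrDl -lerN2 -deriveN; last exact: diff_derivable.
rewrite -[X in _ <= X]addr0; apply: derive_ge.
- by apply: derivableN; apply: diff_derivable.
- exact: cvg_cst.
move=> t t0 t1; rewrite mulr0 addr0.
rewrite -[X in _ <= X]/(- f (y + t *: (z - y)) - - f y).
have := cf (Itv01 (ltW t0) t1) z y (in_setT _) (in_setT _).
rewrite -[X in f X]/(t *: z + (1 - t) *: y) -[X in _ <= X]/(t * f z + (1 - t) * f y).
have -> : t *: z + (1 - t) *: y = y + t *: (z - y).
  by rewrite scalerBr scalerBl scale1r addrCA addrA.
by move=> H; lra.
Qed.

Lemma minimizer_fin (phi : V -> R) (g : V -> \bar R) y : eproper g ->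
  minimizer (composite phi g) y -> g y \is a fin_num.
Proof.
move=> [[x0 gx0] gNy] ymin; rewrite fin_numE gNy /=; apply: contra gx0 => /eqP gy.
by have := ymin x0; rewrite /composite gy addey//; case: (g x0).
Qed.

Lemma sqr_enorm_line x h (t : R) : enorm (x + t *: h) ^+ 2 - enorm x ^+ 2
  = t * (2 * dot x h + t * dot h h).
Proof.
rewrite !sqr_enorm !dotDl !dotDr !dotZl !dotZr (dotC h x); ring.
Qed.

(** Fermat's rule: [y] is compared with [y + t *: (z - y)], convexity bounds [g] on the segment, and
    [t] tends to 0 from the right. *)
Lemma regularized_model_subgradient (phi : V -> R) (g : V -> \bar R)
    (p : nat) (kappa : R) xt y w : (0 < p)%N -> 0 <= kappa ->
  eproper g -> econvex g ->
  (forall h, derivable phi y h /\ 'D_h phi y = dot w h) ->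
  minimizer (composite (fun z => phi z + kappa * enorm (z - xt) ^+ p.+1) g) y ->
  subgradient g y (- w - (p.+1%:R * kappa * enorm (y - xt) ^+ p.-1) *: (y - xt)).
Proof.
move=> p0 k0 gp gc dphi ymin.
have gyfin := minimizer_fin gp ymin; split=> // z.
have [gz|gz] := eqVneq (g z) +oo%E; first by rewrite gz leey.
have gzfin : g z \is a fin_num by rewrite fin_numE gz gp.2.
set h := z - y; set b := y - xt.
(* [enorm] need not be differentiable at [b = 0]; by [pow_sub_le] the increment of
   its power along [h] is at most [t * rho t], whose limit slope is the right one. *)
pose U (t : R) := enorm (b + t *: h).
pose rho (t : R) := kappa * (p.+1%:R / 2 * (U t ^+ p.-1 * (2 * dot b h + t * dot h h))).
have Ucvg : U t @[t --> 0^'+] --> enorm b.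
  apply/cvgrPdist_le => e e0; near=> t.
  have t0 : 0 < t by [].
  have te : t * (enorm h + 1) <= e.
    rewrite -ler_pdivlMr ?ltr_wpDl ?enorm_ge0//; near: t.
    by apply: nbhs_right_le; rewrite divr_gt0// ltr_wpDl ?enorm_ge0.
  have the : t * enorm h <= e by apply: le_trans te; rewrite ler_wpM2l ?lerDl// ltW.
  rewrite ler_distl.
  have H1 : U t <= enorm b + t * enorm h.
    by rewrite -{2}(gtr0_norm t0) -enormZ ler_enormD.
  have H2 : enorm b <= U t + t * enorm h.
    rewrite -{2}(gtr0_norm t0) -enormZ -(enormN (t *: h)).
    by rewrite -{1}[b](addrK (t *: h)) ler_enormD.
  by apply/andP; split; lra.
have rhol : rho t @[t --> 0^'+] -->
    kappa * (p.+1%:R / 2 * (enorm b ^+ p.-1 * (2 * dot b h + 0 * dot h h))).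
  apply: cvgMl_tmp; apply: cvgMl_tmp; apply: cvgM.
    exact: (continuous_cvg _ (@exprn_continuous R p.-1 (enorm b)) Ucvg).
  apply: cvgD; first exact: cvg_cst.
  apply: cvgMr_tmp; apply: cvg_at_right_filter; exact: cvg_id.
have [dy Dy] := dphi h.
have := derive_ge dy rhol (c := fine (g y) - fine (g z)) => key.
suff /key : forall t, 0 < t -> t <= 1 ->
    t * (fine (g y) - fine (g z)) <= phi (y + t *: h) - phi y + t * rho t.
  rewrite Dy mul0r addr0 -(fineK gyfin) -(fineK gzfin) -EFinD lee_fin.
  rewrite [dot (- w - _) _]dotBl [dot (- w) _]dotNl dotZl.
  move: (enorm b ^+ p.-1) (dot b h) (dot w h) => *; lra.
move=> t t0 t1.
have t01 : 0 <= t <= 1 by rewrite ltW.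
have := le_trans (ymin (t *: z + (1 - t) *: y)) (leeD2l _ (gc z y t t01)).
have -> : t *: z + (1 - t) *: y = y + t *: h.
  by rewrite scalerBr scalerBl scale1r addrCA addrA.
rewrite /composite -(fineK gyfin) -(fineK gzfin) -!EFinM -!EFinD lee_fin.
have -> : y + t *: h - xt = b + t *: h by rewrite addrAC.
have := pow_sub_le p0 (enorm_ge0 (b + t *: h)) (enorm_ge0 b).
rewrite sqr_enorm_line -/(U t) => H1 H2.
have -> : t * rho t = kappa * (p.+1%:R * (U t ^+ p.-1 *
    (t * (2 * dot b h + t * dot h h))) / 2).
  by rewrite /rho; ring.
move: (ler_wpM2l k0 H1) H2; rewrite -/b /=.
move: (_ * (2 * dot b h + _)) (phi _) (phi _) (fine _) (fine _) (enorm b) (U t) => *; lra.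
Unshelve. all: by end_near. Qed.

(** The two subgradient inequalities, weighted by [A] and [a], are added; the definition of [xt] and
    [a ^+ 2 = lam * (A + a)] match their sum with the squared residual. The inequality at [y] is
    premultiplied by [A], so it is void when [A = 0]. *)
Lemma ms_step (A a lam : R) x y xt y' v xs (Fy Fy' Fs : R) :
  0 < A + a -> 0 < lam -> 0 <= a -> a ^+ 2 = lam * (A + a) ->
  xt = (A / (A + a)) *: y + (a / (A + a)) *: x ->
  enorm (lam *: v + (y' - xt)) <= enorm (y' - xt) / 2 ->
  A * (Fy' + dot v (y - y')) <= A * Fy ->
  Fy' + dot v (xs - y') <= Fs ->
  (A + a) * (Fy' - Fs) + enorm (x - a *: v - xs) ^+ 2 / 2
    + 3 / 8 * ((A + a) * enorm (y' - xt) ^+ 2 / lam)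
  <= A * (Fy - Fs) + enorm (x - xs) ^+ 2 / 2.
Proof.
move=> A'0 lam0 a0 a2 xtE res Hy Hs.
have {}Hs := ler_wpM2l a0 Hs.
have vxt : (A + a) * dot v xt = A * dot v y + a * dot v x.
  by rewrite xtE dotDr !dotZr; field; exact: lt0r_neq0.
(* 3/4 is 1 - (1/2)^2 from squaring the residual bound; scaling by [(A + a) / (2 * lam)] makes it
   3/8. *)
have {}res : lam ^+ 2 * dot v v + 2 * lam * dot v (y' - xt)
    + 3 / 4 * enorm (y' - xt) ^+ 2 <= 0.
  have : enorm (lam *: v + (y' - xt)) ^+ 2 <= (enorm (y' - xt) / 2) ^+ 2.
    by rewrite ler_sqr ?nnegrE ?divr_ge0 ?enorm_ge0.
  have := sqr_enorm_line (y' - xt) v lam.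
  by rewrite [y' - xt + _]addrC (dotC _ v) expr_div_n; lra.
have {}res : lam * (A + a) / 2 * dot v v + (A + a) * dot v (y' - xt)
    + 3 / 8 * ((A + a) * enorm (y' - xt) ^+ 2 / lam) <= 0.
  have c0 : 0 <= (A + a) / (2 * lam) by rewrite divr_ge0 ?mulr_ge0 ?ltW.
  apply: le_trans (mulr_ge0_le0 c0 res).
  rewrite le_eqVlt; apply/orP; left; apply/eqP; field; exact: lt0r_neq0.
have := sqr_enorm_line (x - xs) v (- a).
rewrite scaleNr addrAC (dotC _ v) => E; move: E res Hy Hs.
have -> : - a * (2 * dot v (x - xs) + - a * dot v v)
  = - 2 * a * dot v (x - xs) + lam * (A + a) * dot v v by rewrite -a2; ring.
rewrite !dotBr; lra.
Qed.

End Optimality.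

(** * Growth of the weights *)

Section Growth.
Context {R : realType}.

(** A Hölder-type inequality, extremal when all [D i] and all [q i] equal their averages. *)
Lemma sum_pow_le (m n N : nat) (kappa W M : R) (D q : nat -> R) : (0 < m)%N ->
  (forall i, (i < N)%N -> [/\ 0 <= D i, 0 <= q i & kappa <= D i ^+ m * q i ^+ n]) ->
  \sum_(i < N) D i <= W -> \sum_(i < N) q i <= M ->
  N%:R ^+ (m + n) * kappa <= W ^+ m * M ^+ n.
Proof.
move=> m0 Dq DW qM.
have [N0|N0] := posnP N.
  move: DW qM; rewrite N0 !big_ord0 => W0 M0.
  by rewrite expr0n addn_eq0 (gtn_eqF m0) mul0r mulr_ge0 ?exprn_ge0.
have W0 : 0 <= W by apply: le_trans DW; apply: sumr_ge0 => i _; have [] := Dq i (ltn_ord i).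
have M0 : 0 <= M by apply: le_trans qM; apply: sumr_ge0 => i _; have [] := Dq i (ltn_ord i).
have Np : 0 < N%:R :> R by rewrite ltr0n.
have [kp|k0] := ltP 0 kappa; last first.
  apply: (@le_trans _ _ 0); last by rewrite mulr_ge0 ?exprn_ge0.
  exact: (mulr_ge0_le0 (exprn_ge0 _ (ltW Np)) k0).
have Dp i : (i < N)%N -> 0 < D i.
  move=> /Dq[Di qi k]; rewrite lt_def Di andbT; apply/eqP => D0.
  by move: (lt_le_trans kp k); rewrite D0 expr0n (gtn_eqF m0) mul0r ltxx.
have qp i : (0 < n)%N -> (i < N)%N -> 0 < q i.
  move=> n0 /Dq[Di qi k]; rewrite lt_def qi andbT; apply/eqP => q0.
  by move: (lt_le_trans kp k); rewrite q0 expr0n (gtn_eqF n0) mulr0 ltxx.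
have sumP (E : nat -> R) : (forall i, (i < N)%N -> 0 < E i) -> 0 < \sum_(i < N) E i.
  move=> E0; rewrite (bigD1 (Ordinal N0))//= ltr_pwDl ?E0//.
  by apply: sumr_ge0 => i _; apply/ltW/E0.
have Wp : 0 < W by apply: lt_le_trans DW; exact: sumP.
(* If the claim fails, AM-GM applied to [D i / a] and [q i / b] with weights [m]
   and [n] gives [m + n < m * (D i / a) + n * (q i / b)], contradicted by averaging. *)
pose a := W / N%:R; pose b := if n == 0%N then 1 else M / N%:R.
have ap : 0 < a by rewrite divr_gt0.
(* For [n = 0] the [q i] may all vanish, and so may [M]; this is why [b] is then set to 1. *)
have bp : 0 < b.
  rewrite /b; case: eqP => [//|/eqP]; rewrite -lt0n => n0.
  by rewrite divr_gt0//; apply: lt_le_trans qM; apply: sumP => i; exact: qp.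
have bn : b ^+ n * N%:R ^+ n = M ^+ n.
  rewrite /b; case: eqP => [->|_]; first by rewrite !expr0 mulr1.
  by rewrite -exprMn divfK ?gt_eqF.
have qb : n%:R * (\sum_(i < N) q i) / b <= n%:R * N%:R.
  rewrite /b; case: eqP => [->|_]; first by rewrite !mul0r.
  have [->|n0] := posnP n; first by rewrite !mul0r.
  have Mp : 0 < M by apply: lt_le_trans qM; apply: sumP => i; exact: qp.
  rewrite -mulrA ler_wpM2l// invf_div mulrA ler_pdivrMr// mulrC.
  by rewrite ler_pM2l.
rewrite leNgt; apply/negP => H.
have step i : (i < N)%N -> (m + n)%:R < m%:R * (D i / a) + n%:R * (q i / b).
  move=> iN; have [Di qi k] := Dq i iN.
  have E := @weighted_agm R m n (D i / a) (q i / b)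
    (divr_ge0 Di (ltW ap)) (divr_ge0 qi (ltW bp)).
  rewrite -(@ltr_pXn2r _ (m + n)%N) ?nnegrE ?addn_gt0 ?m0//; last first.
    by rewrite addr_ge0// mulr_ge0// divr_ge0// ltW.
  apply: lt_le_trans E; rewrite ltr_pMl ?exprn_gt0 ?ltr0n ?addn_gt0 ?m0//.
  rewrite (expr_div_n (D i) a) (expr_div_n (q i) b) mulf_div.
  rewrite ltr_pdivlMr ?mulr_gt0 ?exprn_gt0// mul1r.
  apply: lt_le_trans k; rewrite -(ltr_pM2l (exprn_gt0 (m + n) Np)).
  apply: le_lt_trans H; rewrite exprD -bn {1}/a.
  rewrite le_eqVlt; apply/orP; left; apply/eqP.
  by rewrite expr_div_n; field; rewrite gt_eqF// exprn_gt0.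
have : \sum_(i < N) (m + n)%:R < \sum_(i < N) (m%:R * (D i / a) + n%:R * (q i / b)) :> R.
  apply: ltr_sum => [|i _]; last exact: step.
  by apply/hasP; exists (Ordinal N0) => //; exact: mem_index_enum.
rewrite big_split /= -!mulr_sumr -!mulr_suml sumr_const card_ord.
rewrite -[_ *+ N]mulr_natr natrD mulrDl.
rewrite !mulrA ltNge => /negP; apply.
apply: lerD => //.
rewrite -mulrA ler_wpM2l// ler_pdivrMr// mulrC.
by rewrite /a divfK ?gt_eqF.
Qed.

Lemma powR_root_exp (p : nat) (x : R) : 0 <= x -> (x `^ p.+1%:R^-1) ^+ p.+1 = x.
Proof.
move=> x0; rewrite -powR_mulrn ?powR_ge0// -powRrM mulVf ?powRr1//.
Qed.

(** [a] is the positive root of a quadratic. It is at least lam/2 + sqrt(lam A), so [A + a]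
    dominates the square of sqrt A + sqrt(lam)/2, which gives the last claim. *)
Lemma catd_weight (A lam : R) : 0 <= A -> 0 < lam ->
  let a := (lam + Num.sqrt (lam ^+ 2 + 4 * lam * A)) / 2 in
  [/\ 0 < a, a ^+ 2 = lam * (A + a)
    & Num.sqrt lam <= 2 * Num.sqrt (A + a) - 2 * Num.sqrt A].
Proof.
move=> A0 lam0 a.
have S0 : 0 <= lam ^+ 2 + 4 * lam * A by rewrite addr_ge0 ?sqr_ge0// !mulr_ge0// ltW.
have ap : 0 < a by rewrite divr_gt0// ltr_pwDl// sqrtr_ge0.
have a2 : a ^+ 2 = lam * (A + a).
  have := sqr_sqrtr S0; rewrite /a; set S := Num.sqrt _ => SE.
  have -> : ((lam + S) / 2) ^+ 2 = (lam ^+ 2 + 2 * lam * S + S ^+ 2) / 4 by field.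
  by rewrite SE; field.
split=> //.
have l2 := sqr_sqrtr (ltW lam0); have A2 := sqr_sqrtr A0.
have sl := sqrtr_ge0 lam; have sA := sqrtr_ge0 A.
have H : Num.sqrt A + Num.sqrt lam / 2 <= Num.sqrt (A + a).
  rewrite -ler_sqr ?nnegrE ?addr_ge0 ?divr_ge0 ?sqrtr_ge0// sqr_sqrtr ?addr_ge0 ?(ltW ap)//.
  have H : 2 * (Num.sqrt lam * Num.sqrt A) <= Num.sqrt (lam ^+ 2 + 4 * lam * A).
    rewrite -ler_sqr ?nnegrE ?mulr_ge0 ?sqrtr_ge0// sqr_sqrtr//.
    by rewrite !exprMn l2 A2; have := sqr_ge0 lam; lra.
  by rewrite /a sqrrD expr_div_n l2 A2; lra.
by lra.
Qed.

(** This is (4A)^(1/(p+1)), written as a square so that its increments have the form u^2 - a^2 of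
    [pow_sub_le]. *)
Definition growth_potential (p : nat) (A : R) : R :=
  ((2 * Num.sqrt A) `^ p.+1%:R^-1) ^+ 2.

Lemma growth_potential_exp p A : 0 <= A ->
  growth_potential p A ^+ (2 * p.+1) = (4 * A) ^+ 2.
Proof.
move=> A0; rewrite /growth_potential -exprM mulnA (mulnC _ p.+1) exprM.
rewrite powR_root_exp ?mulr_ge0 ?sqrtr_ge0//.
rewrite (exprM _ 2 2); congr (_ ^+ 2); rewrite exprMn sqr_sqrtr//; ring.
Qed.

(** [pow_sub_le] converts the growth of sqrt A into a lower bound on [Delta] in terms of [lam]; the
    hypothesis on [h] then eliminates [lam] and [D] in favour of the quantity summed in the energy
    estimate. *)
Lemma growth_step (p : nat) (A lam h D : R) : (0 < p)%N -> 0 <= A -> 0 < lam -> 0 <= h ->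
  0 <= D -> h <= lam * D ^+ p.-1 ->
  let A' := A + (lam + Num.sqrt (lam ^+ 2 + 4 * lam * A)) / 2 in
  let Delta := growth_potential p A' - growth_potential p A in
  0 <= Delta /\
  h ^+ 2 / (4 ^+ p.-1 * (p.+1%:R / 2) ^+ (2 * p.+1))
    <= Delta ^+ (2 * p.+1) * (A' * D ^+ 2 / lam) ^+ p.-1.
Proof.
move=> p0 A0 lam0 h0 D0 hD A' Delta.
have [ap _ sle] := catd_weight A0 lam0; rewrite -/A' in sle.
have A'p : 0 < A' by rewrite ltr_wpDl.
pose U := (2 * Num.sqrt A') `^ p.+1%:R^-1; pose U0 := (2 * Num.sqrt A) `^ p.+1%:R^-1.
have UE : U ^+ p.+1 = 2 * Num.sqrt A' by rewrite powR_root_exp// mulr_ge0 ?sqrtr_ge0.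
have U0E : U0 ^+ p.+1 = 2 * Num.sqrt A by rewrite powR_root_exp// mulr_ge0 ?sqrtr_ge0.
have Up : 0 < U by rewrite powR_gt0// mulr_gt0// sqrtr_gt0.
have U0p : 0 <= U0 by rewrite powR_ge0.
have DE : Delta = U ^+ 2 - U0 ^+ 2 by [].
clearbody Delta U U0.
have D0' : 0 <= Delta.
  rewrite DE subr_ge0 ler_sqr ?nnegrE ?(ltW Up)// -(@ler_pXn2r _ p.+1) ?nnegrE ?(ltW Up)//.
  by rewrite UE U0E; have := sqrtr_ge0 lam; lra.
split=> //.
have c0 : 0 < (p.+1%:R / 2 : R) by rewrite divr_gt0// ltr0n.
have s1 : Num.sqrt lam <= p.+1%:R / 2 * (U ^+ p.-1 * Delta).
  have := pow_sub_le p0 (ltW Up) U0p; rewrite UE U0E -DE; lra.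
have s2 : lam ^+ p.+1
    <= (p.+1%:R / 2) ^+ (2 * p.+1) * ((4 * A') ^+ p.-1 * Delta ^+ (2 * p.+1)).
  have -> : lam ^+ p.+1 = Num.sqrt lam ^+ (2 * p.+1) by rewrite exprM sqr_sqrtr// ltW.
  have -> : (4 * A') ^+ p.-1 = U ^+ p.-1 ^+ (2 * p.+1).
    rewrite -exprM [(2 * _)%N]mulnC mulnA [(p.-1 * _)%N]mulnC -mulnA exprM UE mulnC exprM.
    by congr (_ ^+ _); rewrite exprMn sqr_sqrtr ?ltW//; ring.
  rewrite -exprMn -exprMn ler_pXn2r ?nnegrE ?sqrtr_ge0//.
  by rewrite !mulr_ge0// ?exprn_ge0 ?(ltW c0) ?(ltW Up).
have h2 : h ^+ 2 <= lam ^+ 2 * (D ^+ 2) ^+ p.-1.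
  rewrite -exprM mulnC exprM -exprMn ler_pXn2r ?nnegrE// mulr_ge0 ?(ltW lam0)//.
  exact: exprn_ge0.
(* The factor [A' ^+ p.-1] is introduced to form this power; it cancels against [(4 * A') ^+ p.-1]
   in [s2]. *)
have E : lam ^+ 2 * (D ^+ 2) ^+ p.-1 * A' ^+ p.-1
   = lam ^+ p.+1 * (A' * D ^+ 2 / lam) ^+ p.-1.
  have -> : lam ^+ p.+1 = lam ^+ p.-1 * lam ^+ 2 by rewrite -exprD addn2 prednK.
  rewrite !exprMn exprVn; set l := lam ^+ p.-1.
  have l0 : l != 0 by rewrite expf_neq0 ?gt_eqF.
  by field.
rewrite ler_pdivrMr ?mulr_gt0 ?exprn_gt0//.
rewrite -(ler_pM2r (exprn_gt0 p.-1 A'p)).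
apply: le_trans (ler_wpM2r (exprn_ge0 _ (ltW A'p)) h2) _; rewrite E.
have q0 : 0 <= (A' * D ^+ 2 / lam) ^+ p.-1.
  by rewrite exprn_ge0// divr_ge0 ?mulr_ge0 ?exprn_ge0 ?(ltW A'p) ?(ltW lam0).
apply: le_trans (ler_wpM2r q0 s2) _.
rewrite le_eqVlt; apply/orP; left; apply/eqP.
rewrite [(4 * A') ^+ _]exprMn; move: (_ ^+ p.-1) (_ ^+ p.-1) (_ ^+ p.-1) => *; ring.
Qed.

End Growth.

(** * A run of CATD *)

Section CatdRun.
Context {R : realType} {d : nat}.
Local Notation V := 'rV[R]_d.
Variables (p : nat) (L : R) (f : V -> R) (g : V -> \bar R) (xs : V).
Hypothesis p0 : (0 < p)%N.
Hypothesis L0 : 0 <= L.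
Hypothesis fL : lipschitz_Dn p L f.
Hypothesis fconv : convex_function setT f.
Hypothesis gproper : eproper g.
Hypothesis gconv : econvex g.
Hypothesis xsmin : minimizer (composite f g) xs.
Implicit Types (x y z : V) (s : @catd_state R d).

Let F := composite f g.
Let Fr x : R := fine (F x).

Lemma fin_composite x : g x \is a fin_num -> F x = (Fr x)%:E.
Proof. by move=> gx; rewrite /Fr fineK// /F /composite fin_numD gx. Qed.

Lemma fin_composite_min : F xs = (Fr xs)%:E.
Proof. exact/fin_composite/(minimizer_fin gproper xsmin). Qed.

Lemma min_le_composite x : g x \is a fin_num -> Fr xs <= Fr x.
Proof.
by move=> gx; rewrite -lee_fin -fin_composite_min -fin_composite//; exact: xsmin.
Qed.

(** The lower bound on lam D^(p-1) imposed by the left half of the CATD step condition;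
    [growth_rate] is the resulting constant of [growth_step]. *)
Let h0 : R := p.-1`!%:R / (2 * L).

Definition growth_rate : R :=
  h0 ^+ 2 / (4 ^+ p.-1 * (p.+1%:R / 2) ^+ (2 * p.+1)).

(** With [eta] the quantity kept between 1/2 and p/(p+1), the upper bound makes the coefficient of
    [w] nonnegative. The triangle inequality then gives (1 - eta) D, and the lower bound makes this
    at most D/2. *)
Lemma inexact_prox_residual (lam D : R) (e w : V) : 0 < lam ->
  enorm w = D -> enorm e <= L / p`!%:R * D ^+ p ->
  1 / 2 <= lam * (L * D ^+ p.-1 / p.-1`!%:R) <= p%:R / p.+1%:R ->
  enorm (lam *: (e - (p.+1%:R * L / p`!%:R * D ^+ p.-1) *: w) + w) <= D / 2.
Proof.
move=> lam0 wD eD /andP[lo hi].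
have D0 : 0 <= D by rewrite -wD enorm_ge0.
set c := p.+1%:R * L / p`!%:R * D ^+ p.-1.
set eta := lam * _ in lo hi.
have pn0 : p%:R != 0 :> R by rewrite pnatr_eq0 -lt0n.
have pS0 : 0 < p.+1%:R :> R by rewrite ltr0n.
have pfact : p`!%:R = p%:R * p.-1`!%:R :> R.
  by rewrite -natrM -[in LHS](prednK p0) factS prednK.
have fn0 : p.-1`!%:R != 0 :> R by rewrite pnatr_eq0 -lt0n fact_gt0.
have cE : lam * c = eta * (p.+1%:R / p%:R).
  by rewrite /c /eta pfact; field; rewrite pn0 fn0.
have c1 : 0 <= 1 - lam * c.
  rewrite subr_ge0 cE; apply: le_trans (ler_wpM2r _ hi) _.
    by rewrite divr_ge0.
  by rewrite mulrA divfK ?gt_eqF// divff.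
have -> : lam *: (e - c *: w) + w = lam *: e + (1 - lam * c) *: w.
  by rewrite scalerBr scalerA scalerBl scale1r -addrA [_ + w]addrC.
apply: le_trans (ler_enormD _ _) _; rewrite !enormZ (gtr0_norm lam0) (ger0_norm c1) wD.
have eE : lam * (L / p`!%:R * D ^+ p) = eta / p%:R * D.
  by rewrite /eta -{2}(prednK p0) exprS pfact; field; rewrite pn0 fn0.
apply: le_trans (lerD (ler_wpM2l (ltW lam0) eD) (lexx _)) _.
rewrite eE cE -mulrDl mulrC ler_wpM2l//.
have -> : eta / p%:R + (1 - eta * (p.+1%:R / p%:R)) = 1 - eta.
  by rewrite -[p.+1]addn1 natrD; field.
lra.
Qed.

(** The disjunction covers the first step: [g] may be infinite at the starting point, where [Fr] is
    a default value, but it is multiplied by the weight 0. *)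
Lemma catd_step_progress s s' : catd_step p L f g s s' -> 0 <= st_A s ->
  (st_A s = 0 \/ g (st_y s) \is a fin_num) ->
  [/\ 0 < L, 0 < st_A s', g (st_y s') \is a fin_num & exists q : R,
    [/\ 0 <= q,
     st_A s' * (Fr (st_y s') - Fr xs) + enorm (st_x s' - xs) ^+ 2 / 2 + 3 / 8 * q
       <= st_A s * (Fr (st_y s) - Fr xs) + enorm (st_x s - xs) ^+ 2 / 2,
     0 <= growth_potential p (st_A s') - growth_potential p (st_A s) &
     growth_rate <= (growth_potential p (st_A s') - growth_potential p (st_A s))
        ^+ (2 * p.+1) * q ^+ p.-1]].
Proof.
move=> [lam]; set a := (lam + _) / 2; set A := st_A s.
set y' := st_y s' => -[lam0 eta y'min A'E x'E] A0 yfin.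
set xt := (_ *: _ + _ *: _) in eta y'min x'E.
set D := enorm (y' - xt) in eta x'E.
have D0 : 0 <= D := enorm_ge0 _.
(* With [L = 0] the step condition would read 1/2 <= 0. *)
have Lp : 0 < L.
  rewrite lt_def L0 andbT; apply/eqP => L00.
  by move: eta; rewrite L00 !mul0r mulr0 => /andP[+ _]; lra.
have [ap a2 _] := catd_weight A0 lam0; rewrite -/a in ap a2.
have A'p : 0 < A + a by rewrite ltr_wpDl.
have dphi h : derivable (taylor p f xt) y' h /\
    'D_h (taylor p f xt) y' = dot (grad (taylor p f xt) y') h.
  have H := is_derive_taylor fL xt y' h.
  by rewrite (dot_grad_taylor fL); split; [exact: ex_derive|exact: derive_val].
have k0 : 0 <= L / p`!%:R by rewrite divr_ge0.
have [gy'fin gsub] := regularized_model_subgradient p0 k0 gproper gconv dphi y'min.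
set g' := - _ - _ *: _ in x'E.
have g'E : - grad (taylor p f xt) y' -
    (p.+1%:R * (L / p`!%:R) * enorm (y' - xt) ^+ p.-1) *: (y' - xt) = g'.
  by rewrite /g' [p.+1%:R * (L / _)]mulrA.
rewrite g'E in gsub.
pose v := grad f y' + g'.
have Fsub z : g z \is a fin_num -> Fr y' + dot v (z - y') <= Fr z.
  move=> gz; rewrite -lee_fin EFinD -!fin_composite// /F /composite /v dotDl.
  have := gsub z; have := convex_grad_le (y := y') z fconv (fL.1 [::] p0 y').
  rewrite -(fineK gz) -(fineK gy'fin) -!EFinD !lee_fin; lra.
have res : enorm (lam *: v + (y' - xt)) <= D / 2.
  have -> : v = grad f y' - grad (taylor p f xt) y'
      - (p.+1%:R * L / p`!%:R * D ^+ p.-1) *: (y' - xt).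
    by rewrite /v /g' addrA.
  apply: inexact_prox_residual => //.
  exact: (grad_taylor_bound L0 fL).
have xtE : xt = (A / (A + a)) *: st_y s + (a / (A + a)) *: st_x s by [].
have Hy : A * (Fr y' + dot v (st_y s - y')) <= A * Fr (st_y s).
  case: yfin => [->|gy]; first by rewrite !mul0r.
  by rewrite ler_wpM2l// Fsub.
have Hs := Fsub xs (minimizer_fin gproper xsmin).
have ms := ms_step A'p lam0 (ltW ap) a2 xtE res Hy Hs.
have h00 : 0 <= h0 by rewrite divr_ge0// mulr_ge0.
have fn0 : p.-1`!%:R != 0 :> R by rewrite pnatr_eq0 -lt0n fact_gt0.
have hD : h0 <= lam * D ^+ p.-1.
  have /andP[+ _] := eta; rewrite /h0.
  rewrite [lam * _](_ : _ = lam * D ^+ p.-1 * (L / p.-1`!%:R)); last by ring.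
  rewrite -ler_pdivrMr ?divr_gt0 ?ltr0n ?fact_gt0// => H; apply: le_trans H.
  rewrite le_eqVlt; apply/orP; left; apply/eqP; field.
  by rewrite (gt_eqF Lp) fn0.
have [gr1 gr2] := growth_step p0 A0 lam0 h00 D0 hD.
split => //; first by rewrite A'E.
exists ((A + a) * D ^+ 2 / lam); split.
- by rewrite divr_ge0 ?(ltW lam0)// mulr_ge0 ?(ltW A'p) ?exprn_ge0.
- have -> : st_x s' = st_x s - a *: v.
    have E (z u w : V) : z - a *: u - a *: w = z - a *: (u + w).
      by rewrite scalerDr opprD addrA.
    by rewrite x'E E.
  by rewrite A'E; exact: ms.
- by rewrite A'E.
- by rewrite A'E.
Qed.

Lemma catd_bound (x0 out : V) N : (0 < N)%N -> catd p L f g x0 N out ->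
  exists A : R, [/\ 0 < L, g out \is a fin_num,
    0 <= A,
    A * (Fr out - Fr xs) <= enorm (x0 - xs) ^+ 2 / 2 &
    N%:R ^+ (3 * p + 1) * growth_rate
      <= (4 * A) ^+ 2 * (4 / 3 * enorm (x0 - xs) ^+ 2) ^+ p.-1].
Proof.
move=> N0 [s [s0 steps ->]].
have inv k : (k < N)%N -> 0 <= st_A (s k) /\
    (st_A (s k) = 0 \/ g (st_y (s k)) \is a fin_num).
  elim: k => [|k IH] kN; first by rewrite s0; split=> //; left.
  have [A0 yfin] := IH (ltnW kN).
  by have [_ /ltW ? ? _] := catd_step_progress (steps k (ltnW kN)) A0 yfin; split=> //; right.
have prog k (kN : (k < N)%N) := catd_step_progress (steps k kN) (inv k kN).1 (inv k kN).2.
have [Lp _ _ _] := prog 0%N N0.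
have [AN yN] : 0 < st_A (s N) /\ g (st_y (s N)) \is a fin_num.
  by have := prog N.-1; rewrite (prednK N0) => /(_ (leqnn _))[].
pose G k := growth_potential p (st_A (s k)).
have [q qP] : exists q : nat -> R, forall k, (k < N)%N -> [/\ 0 <= q k,
     st_A (s k.+1) * (Fr (st_y (s k.+1)) - Fr xs)
       + enorm (st_x (s k.+1) - xs) ^+ 2 / 2 + 3 / 8 * q k
       <= st_A (s k) * (Fr (st_y (s k)) - Fr xs) + enorm (st_x (s k) - xs) ^+ 2 / 2,
     0 <= G k.+1 - G k & growth_rate <= (G k.+1 - G k) ^+ (2 * p.+1) * q k ^+ p.-1].
  suff /choice[q qP] : forall k, exists r : R, (k < N)%N -> [/\ 0 <= r,
     st_A (s k.+1) * (Fr (st_y (s k.+1)) - Fr xs)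
       + enorm (st_x (s k.+1) - xs) ^+ 2 / 2 + 3 / 8 * r
       <= st_A (s k) * (Fr (st_y (s k)) - Fr xs) + enorm (st_x (s k) - xs) ^+ 2 / 2,
     0 <= G k.+1 - G k & growth_rate <= (G k.+1 - G k) ^+ (2 * p.+1) * r ^+ p.-1].
    by exists q.
  move=> k; case: (boolP (k < N)%N) => [kN|_]; last by exists 0.
  by have [_ _ _ [r ?]] := prog k kN; exists r.
have tele k : (k <= N)%N -> st_A (s k) * (Fr (st_y (s k)) - Fr xs)
    + enorm (st_x (s k) - xs) ^+ 2 / 2 + 3 / 8 * \sum_(i < k) q i
    <= enorm (x0 - xs) ^+ 2 / 2.
  elim: k => [|k IH] kN; first by rewrite s0 /= big_ord0 mul0r mulr0 add0r addr0.
  have [_ H _ _] := qP k kN; apply: le_trans (IH (ltnW kN)).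
  by rewrite big_ord_recr /=; lra.
have AF : 0 <= st_A (s N) * (Fr (st_y (s N)) - Fr xs).
  by rewrite mulr_ge0 ?(ltW AN)// subr_ge0 min_le_composite.
have q0 : 0 <= \sum_(i < N) q i.
  by apply: sumr_ge0 => i _; have [] := qP i (ltn_ord i).
have xN := sqr_ge0 (enorm (st_x (s N) - xs)).
have teleN := tele N (leqnn _).
exists (st_A (s N)); split=> //; first exact: ltW.
  by lra.
rewrite -(growth_potential_exp p) ?(ltW AN)//.
(* The exponents are those of the increments and of [q]. The increments telescope, and 3/8 of the
   sum of [q] is at most half the squared initial distance, whence 4/3. *)
have -> : (3 * p + 1 = 2 * p.+1 + p.-1)%N by case: (p) p0 => // n _; rewrite !mulnS; lia.
apply: (@sum_pow_le _ _ _ _ _ _ _ (fun k => G k.+1 - G k) q) => //.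
- by move=> i iN; have [] := qP i iN.
- rewrite -(big_mkord xpredT (fun k => G k.+1 - G k)) telescope_sumr//.
  by rewrite lerBlDr lerDl exprn_ge0// powR_ge0.
- by lra.
Qed.

End CatdRun.

(** * Comparison of the derived rate with the constant [catd_const] *)

Section RateConstants.
Context {R : realType}.
Implicit Types (p k : nat) (r L sigma x : R).

Lemma sqr_powR_half (m : nat) x : 0 <= x -> (x `^ (m%:R / 2)) ^+ 2 = x ^+ m.
Proof.
by move=> x0; rewrite -powR_mulrn ?powR_ge0// -powRrM divfK// powR_mulrn.
Qed.

Lemma catd_const_gt0 p : 0 < catd_const p :> R.
Proof.
by rewrite /catd_const divr_gt0 ?ltr0n ?fact_gt0// mulr_gt0 ?exprn_gt0 ?powR_gt0 ?ltr0n.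
Qed.

(** After squaring, the right side times [growth_rate] is (4A)^2 (4 (p+1) r^2)^(p-1); [catd_const]
    leaves room to enlarge 4/3 to 4 (p+1). *)
Lemma catd_weight_bound p L (A r : R) N : (0 < p)%N -> 0 < L -> 0 <= A -> 0 <= r ->
  N%:R ^+ (3 * p + 1) * growth_rate p L <= (4 * A) ^+ 2 * (4 / 3 * r ^+ 2) ^+ p.-1 ->
  N%:R `^ ((3 * p + 1)%:R / 2) <= 2 * catd_const p * L * r ^+ p.-1 * A.
Proof.
case: p => // n _ L0 A0 r0; rewrite succnK => H.
have c0 := catd_const_gt0 n.+1.
rewrite -ler_sqr ?nnegrE ?powR_ge0//; last first.
  by rewrite !mulr_ge0 ?exprn_ge0// ltW.
rewrite sqr_powR_half//.
have g0 : 0 < growth_rate n.+1 L.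
  have f0 : 0 < n`!%:R :> R by rewrite ltr0n fact_gt0.
  have n0 : 0 < n.+2%:R :> R by rewrite ltr0n.
  by rewrite /growth_rate divr_gt0// ?exprn_gt0 ?divr_gt0 ?mulr_gt0 ?exprn_gt0 ?divr_gt0.
rewrite -(ler_pM2r g0); apply: le_trans H _.
have -> : (2 * catd_const n.+1 * L * r ^+ n * A) ^+ 2 * growth_rate n.+1 L
  = (4 * A) ^+ 2 * (4 * n.+2%:R * r ^+ 2) ^+ n.
  rewrite /growth_rate /catd_const succnK.
  have -> : (2 * (2 ^+ n * n.+2%:R `^ ((3 * n.+1 + 1)%:R / 2) / n`!%:R) * L * r ^+ n * A) ^+ 2
    = 4 * (2 ^+ n) ^+ 2 * (n.+2%:R `^ ((3 * n.+1 + 1)%:R / 2)) ^+ 2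
       / n`!%:R ^+ 2 * L ^+ 2 * (r ^+ n) ^+ 2 * A ^+ 2.
    by field; rewrite pnatr_eq0 -lt0n fact_gt0.
  rewrite sqr_powR_half//.
  have -> : (3 * n.+1 + 1 = 2 * n.+2 + n)%N by lia.
  rewrite exprD.
  have fourE : 4 ^+ n = (2 ^+ n) ^+ 2 :> R.
    by rewrite -exprM mulnC exprM; congr (_ ^+ _); ring.
  rewrite fourE.
  have -> : (n.+2%:R / 2) ^+ (2 * n.+2)
      = n.+2%:R ^+ (2 * n.+2) / (4 * 4 * (2 ^+ n) ^+ 2) :> R.
    rewrite expr_div_n; congr (_ / _).
    by rewrite mulnC exprM -[n.+2]addn2 exprD; ring.
  rewrite [(_ * r ^+ 2) ^+ n]exprMn [r ^+ 2 ^+ n]exprAC [(4 * _) ^+ n]exprMn fourE.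
  have f0 : n`!%:R != 0 :> R by rewrite pnatr_eq0 -lt0n fact_gt0.
  have p0 : n.+2%:R ^+ (2 * n.+2) != 0 :> R by rewrite expf_neq0// pnatr_eq0.
  have p20 : 2 ^+ n != 0 :> R by rewrite expf_neq0.
  have L00 := lt0r_neq0 L0.
  move: (n.+2%:R ^+ (2 * n.+2)) p0 (n.+2%:R ^+ n) (2 ^+ n) p20 (n`!%:R) f0 (r ^+ n).
  move=> a a0 b c cn e en w.
  by field; rewrite a0 cn en L00.
rewrite ler_wpM2l ?sqr_ge0//; apply: lerXn2r.
- by rewrite nnegrE mulr_ge0 ?exprn_ge0.
- by rewrite nnegrE !mulr_ge0 ?exprn_ge0.
have : 2 <= n.+2%:R :> R by rewrite ler_nat.
by move=> n2; rewrite ler_wpM2r ?exprn_ge0//; lra.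
Qed.

End RateConstants.

(** * Restarts *)

Section RestartSchedule.
Context {R : realType}.
Variables (p : nat) (r : R).
Hypothesis r2 : 2 <= r.
Implicit Types (k : nat) (L sigma x : R).

Lemma restart_radius_ge0 (R0 : R) k : 0 <= R0 -> 0 <= restart_radius R0 k.
Proof. by move=> H; rewrite /restart_radius mulr_ge0 ?invr_ge0 ?exprn_ge0. Qed.

Lemma restart_radiusS (R0 : R) k : restart_radius R0 k.+1 = restart_radius R0 k / 2.
Proof. by rewrite /restart_radius exprSr invfM mulrA. Qed.

Lemma absz_ceil_ge x : 0 <= x -> x <= `|Num.ceil x|%N%:R.
Proof.
by move=> x0; rewrite natr_absz ger0_norm ?ceil_ge// ceil_ge0; apply: lt_le_trans x0.
Qed.

Lemma absz_ceil_le x : 0 <= x -> `|Num.ceil x|%N%:R <= x + 1.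
Proof.
move=> x0; rewrite natr_absz ger0_norm; last by rewrite ceil_ge0; apply: lt_le_trans x0.
by have := ceilB1_lt x; rewrite intrB; lra.
Qed.

Lemma restart_steps_lower L sigma (R0 : R) k : 0 <= L -> 0 < sigma ->
  r * catd_const p * L * 2 `^ r / sigma * restart_radius R0 k `^ (p%:R + 1 - r)
  <= (restart_steps p r L sigma R0 k)%:R `^ ((3 * p + 1)%:R / 2).
Proof.
move=> L0 s0; rewrite /restart_steps.
set T := _ * restart_radius R0 k `^ _.
have T0 : 0 <= T.
  rewrite !mulr_ge0 ?powR_ge0 ?invr_ge0 ?(ltW s0) ?(ltW (catd_const_gt0 p))//.
  by apply: le_trans r2.
have e0 : (3 * p + 1)%:R != 0 :> R by rewrite pnatr_eq0 addn1.
rewrite -[leLHS]powRr1//.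
rewrite -[X in T `^ X](_ : 2 / (3 * p + 1)%:R * ((3 * p + 1)%:R / 2) = 1); last by field.
rewrite powRrM; apply: ge0_ler_powR; rewrite ?nnegrE ?powR_ge0 ?divr_ge0//.
apply: le_trans (absz_ceil_ge (powR_ge0 _ _)) _.
by rewrite ler_nat leq_maxl.
Qed.

(** The bound is uniform in [k]: the radii decrease and their exponent p + 1 - r is nonnegative.
    Rounding costs at most 2, absorbed by the maximum with 1. *)
Lemma restart_steps_upper L sigma (R0 : R) k :
  r <= p%:R + 1 -> 0 <= L -> 0 < sigma -> 0 <= R0 ->
  (restart_steps p r L sigma R0 k)%:R <=
    ((r * catd_const p * 2 `^ r) `^ (2 / (3 * p + 1)%:R) + 2)
     * Num.max 1 ((L * R0 `^ (p%:R + 1 - r) / sigma) `^ (2 / (3 * p + 1)%:R)).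
Proof.
move=> hr L0 s0 R00; set theta := 2 / _; set e := p%:R + 1 - r.
have th0 : 0 <= theta by rewrite divr_ge0.
have e0 : 0 <= e by rewrite subr_ge0.
have r0 : 0 <= r by apply: le_trans r2.
have c0 := ltW (catd_const_gt0 p : 0 < _ :> R).
have B0 : 0 <= r * catd_const p * 2 `^ r by rewrite !mulr_ge0 ?powR_ge0.
set B := (_ * 2 `^ r) `^ theta; set Y := (_ / sigma) `^ theta.
have BY0 : 0 <= B * Y by rewrite mulr_ge0 ?powR_ge0.
have step : (restart_steps p r L sigma R0 k)%:R <= B * Y + 2.
  rewrite /restart_steps -/theta -/e; set X := _ `^ theta.
  have XBY : X <= B * Y.
    rewrite /B /Y -powRM//; last by rewrite divr_ge0 ?mulr_ge0 ?powR_ge0 ?(ltW s0).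
    apply: ge0_ler_powR => //.
    - by rewrite nnegrE !mulr_ge0 ?powR_ge0 ?invr_ge0 ?(ltW s0).
    - by rewrite nnegrE !mulr_ge0 ?powR_ge0 ?invr_ge0 ?(ltW s0).
    have : restart_radius R0 k `^ e <= R0 `^ e.
      apply: ge0_ler_powR => //; rewrite ?nnegrE ?restart_radius_ge0//.
      by rewrite /restart_radius ler_piMr// invf_le1 ?exprn_gt0// exprn_ege1// ler1n.
    have H : 0 <= r * catd_const p * L * 2 `^ r / sigma.
      by rewrite !mulr_ge0 ?powR_ge0 ?invr_ge0 ?(ltW s0).
    move=> /(ler_wpM2l H); congr (_ <= _); ring.
  have X0 : 0 <= X by rewrite powR_ge0.
  have [_|_] := leqP `|Num.ceil X| 1; first by rewrite (@le_trans _ _ 2) ?ler1n ?lerDr.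
  by apply: le_trans (absz_ceil_le X0) _; lra.
apply: le_trans step _; rewrite mulrDl.
rewrite lerD// ?ler_wpM2l ?powR_ge0 ?le_max ?lexx ?orbT//.
by rewrite -[leLHS]mulr1 ler_wpM2l// le_max lexx.
Qed.

End RestartSchedule.

Section Restart.
Context {R : realType} {d : nat}.
Local Notation V := 'rV[R]_d.
Variables (p : nat) (r L sigma : R) (f : V -> R) (g : V -> \bar R) (xs : V).
Hypothesis p0 : (0 < p)%N.
Hypothesis r2 : 2 <= r.
Hypothesis L0 : 0 <= L.
Hypothesis fL : lipschitz_Dn p L f.
Hypothesis fconv : convex_function setT f.
Hypothesis gproper : eproper g.
Hypothesis gconv : econvex g.
Hypothesis sigma0 : 0 < sigma.
Hypothesis Funif : uniformly_convex r sigma (composite f g).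
Hypothesis xsmin : minimizer (composite f g) xs.
Implicit Types (x y z : V).

Let F := composite f g.
Let Fr x : R := fine (F x).
Let r0 : 0 < r. Proof. by apply: lt_le_trans r2. Qed.

Lemma uniformly_convex_gap x : g x \is a fin_num ->
  sigma / r * enorm (x - xs) `^ r <= Fr x - Fr xs.
Proof.
move=> gx; rewrite lerBrDl -lee_fin EFinD.
rewrite -(fin_composite_min gproper xsmin) -(fin_composite f gx).
have sub : subgradient F xs 0.
  split=> [|y]; first by rewrite [F xs](fin_composite_min gproper xsmin).
  by rewrite dot0l adde0; exact: xsmin.
by have := Funif sub x; rewrite dot0l add0r.
Qed.

(** The step count makes the CATD bound equal to the gap which, by uniform convexity, forces the
    distance to the minimizer below half the current radius. *)
Lemma restart_contraction (R0 : R) k z z' : 0 <= R0 ->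
  enorm (z - xs) <= restart_radius R0 k ->
  catd p L f g z (restart_steps p r L sigma R0 k) z' ->
  [/\ g z' \is a fin_num,
    Fr z' - Fr xs <= sigma / r * restart_radius R0 k.+1 `^ r &
    enorm (z' - xs) <= restart_radius R0 k.+1].
Proof.
move=> R00 zk; have low := restart_steps_lower p r2 R0 k L0 sigma0.
set N := restart_steps _ _ _ _ _ _ in low * => run.
have N0 : (0 < N)%N by rewrite leq_max orbT.
have [A [Lp gz' A0 AF HN]] := catd_bound p0 L0 fL fconv gproper gconv xsmin N0 run.
set rho := restart_radius R0 k in zk low *.
have rho0 : 0 <= rho by rewrite restart_radius_ge0.
have gap0 : 0 <= Fr z' - Fr xs by rewrite subr_ge0 (min_le_composite gproper xsmin).
have c0 : 0 < catd_const p :> R := catd_const_gt0 p.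
have gap : Fr z' - Fr xs <= sigma / r * restart_radius R0 k.+1 `^ r.
  have := catd_weight_bound p0 Lp A0 (enorm_ge0 _) HN.
  set e := enorm _ in zk AF *; have e0 : 0 <= e := enorm_ge0 _.
  move=> /(ler_wpM2r gap0) H.
  have {}H : N%:R `^ ((3 * p + 1)%:R / 2) * (Fr z' - Fr xs) <= catd_const p * L * rho ^+ p.+1.
    apply: le_trans H _.
    have c2 : 0 <= 2 * catd_const p * L * e ^+ p.-1.
      by rewrite !mulr_ge0 ?exprn_ge0 ?(ltW c0).
    rewrite -[_ * A * _]mulrA; apply: le_trans (ler_wpM2l c2 AF) _.
    have -> : 2 * catd_const p * L * e ^+ p.-1 * (e ^+ 2 / 2) = catd_const p * L * e ^+ p.+1.
      have -> : e ^+ p.+1 = e ^+ p.-1 * e ^+ 2 by rewrite -exprD addn2 prednK.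
      by field.
    rewrite ler_wpM2l ?mulr_ge0 ?(ltW c0)//.
    by apply: lerXn2r; rewrite ?nnegrE.
  rewrite restart_radiusS -/rho.
  (* At radius 0 the powers of [rho] cannot be cancelled, but the gap is nonpositive since at least
     one step is made. *)
  have [rho00|rhoN0] := eqVneq rho 0.
    move: H; rewrite rho00 mul0r (powR0 (lt0r_neq0 r0)) expr0n !mulr0.
    by rewrite pmulr_rle0// powR_gt0// ltr0n.
  have rhop : 0 < rho by rewrite lt_def rhoN0.
  have rhoE : rho ^+ p.+1 = rho `^ (p%:R + 1 - r) * (2 `^ r * (rho / 2) `^ r).
    rewrite -powRM ?divr_ge0// -[2 * _](_ : rho = _); last by field.
    by rewrite -powRD ?rhoN0 ?implybT// subrK natr1 powR_mulrn.
  have {H} := le_trans (ler_wpM2r gap0 low) H; rewrite rhoE.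
  pose K := catd_const p * L * (rho `^ (p%:R + 1 - r) * 2 `^ r).
  have Kp : 0 < K by rewrite !mulr_gt0 ?powR_gt0.
  have -> : r * catd_const p * L * 2 `^ r / sigma * rho `^ (p%:R + 1 - r) * (Fr z' - Fr xs)
     = K * (r / sigma * (Fr z' - Fr xs)) by rewrite /K; ring.
  have -> : catd_const p * L * (rho `^ (p%:R + 1 - r) * (2 `^ r * (rho / 2) `^ r))
     = K * (rho / 2) `^ r by rewrite /K; ring.
  rewrite ler_pM2l// -(ler_pM2l (divr_gt0 sigma0 r0)).
  by rewrite mulrA mulf_div (mulrC sigma) divff ?mul1r// mulf_neq0 ?lt0r_neq0.
split=> //.
have := le_trans (uniformly_convex_gap gz') gap.
rewrite ler_pM2l ?divr_gt0// => H.
rewrite leNgt; apply/negP => /(gt0_ltr_powR r0).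
by rewrite !nnegrE enorm_ge0 restart_radius_ge0// ltNge H => /(_ isT isT).
Qed.

Lemma restarted_catd_radius K (z : nat -> V) :
  restarted_catd p r L sigma f g (enorm (0 - xs)) K z ->
  forall k, (k <= K)%N -> enorm (z k - xs) <= restart_radius (enorm (0 - xs)) k.
Proof.
move=> [z0 run]; elim=> [|k IH] kK.
  by rewrite z0 /restart_radius expr0 invr1 mulr1.
by have [] := restart_contraction (enorm_ge0 _) (IH (ltnW kK)) (run k kK).
Qed.

Lemma restarted_catd_gap K (z : nat -> V) :
  restarted_catd p r L sigma f g (enorm (0 - xs)) K z ->
  forall k, (k < K)%N -> g (z k.+1) \is a fin_num /\
    Fr (z k.+1) - Fr xs <= sigma * enorm (0 - xs) `^ r * 2^-1 ^+ k.+1.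
Proof.
move=> zP k kK.
have [gz gap _] := restart_contraction (enorm_ge0 _)
  (restarted_catd_radius zP (ltnW kK)) (zP.2 k kK).
split=> //; apply: le_trans gap _.
(* Dropping the exponent [r] costs only a constant factor in the number of restarts. *)
have h1 : (2^-1 ^+ k.+1 : R) `^ r <= 2^-1 ^+ k.+1.
  apply: ge1r_powR; last by apply: le_trans r2; rewrite ler1n.
  by rewrite exprn_gt0// exprn_ile1// invf_le1// ler1n.
rewrite /restart_radius -exprVn powRM ?enorm_ge0 ?exprn_ge0//.
rewrite mulrA; apply: ler_pM => //; rewrite ?powR_ge0//.
  by rewrite mulr_ge0 ?powR_ge0 ?divr_ge0 ?(ltW sigma0) ?(ltW r0).
rewrite ler_wpM2r ?powR_ge0// ler_pdivrMr// ler_peMr ?(ltW sigma0)//.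
by apply: le_trans r2; rewrite ler1n.
Qed.

Lemma restarted_catd_cvg (z : nat -> V) :
  (forall K, restarted_catd p r L sigma f g (enorm (0 - xs)) K z) ->
  z k @[k --> \oo] --> xs /\ F (z k) @[k --> \oo] --> F xs.
Proof.
move=> zP.
have geo (c : R) : c * 2^-1 ^+ k @[k --> \oo] --> 0.
  by apply: cvg_geometric; rewrite ger0_norm ?invr_ge0// invf_lt1// ltr1n.
split.
  apply/cvgrPdist_le => e e0.
  have /cvgr0Pnorm_le /(_ e e0) := geo (enorm (0 - xs)).
  apply: filterS => k; rewrite ger0_norm ?mulr_ge0 ?enorm_ge0 ?exprn_ge0 ?invr_ge0// => H.
  have {}H : enorm (z k - xs) <= e.
    apply: le_trans H; rewrite exprVn.
    exact: (restarted_catd_radius (zP k)).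
  rewrite distrC -[leLHS]/(mx_norm (z k - xs)).
  have [->|/mx_norm_neq0[[i j] /= ->]] := eqVneq (mx_norm (z k - xs)) 0; first exact: ltW.
  by rewrite ord1; apply: le_trans (coord_le_enorm _ _) H.
have FE : F xs = (Fr xs)%:E := fin_composite_min gproper xsmin.
(* [F] may be infinite at the starting point; the gap is controlled from the first restart on. *)
rewrite -cvg_shiftS FE.
have gapP k := restarted_catd_gap (zP k.+1) (ltnSn k).
apply: cvg_EFin.
  near=> k; rewrite /= -[F _]/(composite f g (z k.+1)).
  by rewrite (fin_composite f (gapP k).1).
rewrite -[X in X @ _ --> _]/(fun k => Fr (z k.+1)).
apply: (@squeeze_cvgr _ _ _ _ (cst (Fr xs)) (fun k =>
    Fr xs + sigma * enorm (0 - xs) `^ r * 2^-1 ^+ k.+1)).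
- near=> k; have [gz gap] := gapP k.
  by rewrite /cst (min_le_composite gproper xsmin)//=; lra.
- exact: cvg_cst.
rewrite -[X in _ --> X]addr0; apply: cvgD; first exact: cvg_cst.
rewrite (cvg_shiftS (fun k => sigma * enorm (0 - xs) `^ r * 2^-1 ^+ k)).
exact: geo.
Unshelve. all: by end_near. Qed.

End Restart.

(** * Number of restarts and total complexity *)

Lemma nat_log_bound (R : realType) (x : R) : 0 <= x ->
  exists2 K : nat, (0 < K)%N & x <= 2 ^+ K /\ K%:R <= 2 / ln 2 * ln (2 + x).
Proof.
move=> x0; have l2 : 0 < ln 2 :> R by rewrite ln_gt0// ltr1n.
have lx : ln 2 <= ln (2 + x) by rewrite ler_ln ?posrE ?lerDl// ltr_wpDr.
have q0 : 0 <= ln (2 + x) / ln 2 by rewrite divr_ge0 ?(ltW l2)// (le_trans (ltW l2)).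
(* The shift by 2 keeps this quotient at least 1, so rounding up at most doubles it, even for tiny
   [x]. *)
exists (Num.truncn (ln (2 + x) / ln 2)).+1 => //.
have /andP[lo hi] := truncn_itv q0; set T := Num.truncn _ in lo hi *; split.
  have : 2 + x <= 2 ^+ T.+1.
    rewrite -ler_ln ?posrE ?exprn_gt0 ?ltr_wpDr// lnXn// -[_ *+ T.+1]mulr_natl -ler_pdivrMr//.
    exact: ltW.
  by apply: le_trans; rewrite lerDr.
have q1 : 1 <= ln (2 + x) / ln 2 by rewrite ler_pdivlMr// mul1r.
rewrite [leRHS](_ : _ = 2 * (ln (2 + x) / ln 2)); last by ring.
by rewrite -addn1 natrD; lra.
Qed.

(** The constants hidden in the soft O are chosen before the dimension, the problem data and the
    accuracy. The maximum with 1 reflects that every restart makes at least one step. *)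
Theorem theorem2 (R : realType) (p : nat) (r : R) (hp : (1 <= p)%N)
    (hr : 2 <= r) (hpr : r <= p%:R + 1) :
  exists (C : R) (q : nat),
  forall (d : nat) (f : 'rV[R]_d -> R) (g : 'rV[R]_d -> \bar R)
    (L sigma : R) (xs : 'rV[R]_d),
  let F := composite f g in
  let R0 := enorm (0 - xs) in
  let steps := restart_steps p r L sigma R0 in
  convex_function setT f ->
  0 <= L ->
  lipschitz_Dn p L f ->
  eproper g -> eclosed g -> econvex g ->
  0 < sigma ->
  uniformly_convex r sigma F ->
  minimizer F xs ->
  (forall z : nat -> 'rV[R]_d,
     (forall K : nat, restarted_catd p r L sigma f g R0 K z) ->
     z k @[k --> \oo] --> xs /\ F (z k) @[k --> \oo] --> F xs) /\
  (forall eps : R, 0 < eps ->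
     exists K : nat,
       (\sum_(k < K) steps k)%:R
         <= C * Num.max 1 ((L * R0 `^ (p%:R + 1 - r) / sigma)
                             `^ (2 / (3 * p + 1)%:R))
              * ln (2 + sigma * R0 `^ r / eps) ^+ q /\
       forall z : nat -> 'rV[R]_d,
         restarted_catd p r L sigma f g R0 K z ->
         (F (z K) - F xs <= eps%:E)%E).
Proof.
pose theta : R := 2 / (3 * p + 1)%:R.
pose B := (r * catd_const p * 2 `^ r) `^ theta + 2.
have B0 : 0 <= B by rewrite addr_ge0 ?powR_ge0.
(* 2 / ln 2 comes from the number of restarts and [B] from the cost of each; a single logarithmic
   factor suffices. *)
exists (2 / ln 2 * B), 1%N => d f g L sigma xs F R0 steps.
move=> fconv L0 fL gproper _ gconv sigma0 Funif xsmin.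
split=> [z zP|eps eps0].
  exact: (restarted_catd_cvg hp hr L0 fL fconv gproper gconv sigma0 Funif xsmin zP).
have R00 : 0 <= R0 := enorm_ge0 _.
have X0 : 0 <= sigma * R0 `^ r / eps.
  by rewrite divr_ge0 ?mulr_ge0 ?powR_ge0 ?(ltW sigma0)// ltW.
have [[//|K] _ [KX Kln]] := nat_log_bound X0.
exists K.+1; split.
  set M := Num.max _ _.
  have M1 : 1 <= M by rewrite le_max lexx.
  apply: (@le_trans _ _ (\sum_(k < K.+1) B * M)).
    rewrite natr_sum; apply: ler_sum => k _.
    exact: restart_steps_upper.
  rewrite sumr_const card_ord -[_ *+ K.+1]mulr_natl expr1.
  have BM : 0 <= B * M by rewrite mulr_ge0// (le_trans ler01).
  by apply: le_trans (ler_wpM2r BM Kln) _; rewrite le_eqVlt; apply/orP; left; apply/eqP; ring.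
move=> z zP.
have [gz gap] := restarted_catd_gap hp hr L0 fL fconv gproper gconv sigma0 Funif
  xsmin zP (ltnSn K).
rewrite /F (fin_composite f gz) (fin_composite_min gproper xsmin) -EFinB lee_fin.
apply: le_trans gap _.
by rewrite exprVn ler_pdivrMr ?exprn_gt0// [eps * _]mulrC -ler_pdivrMr.
Qed.
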